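(* Let $0<\alpha<1$ and let $(\lambda_{\alpha,n})_{n\ge0}$ be the sequence of eigenvalues of $\Delta_\alpha$ arranged in increasing order, counting multiplicities. Then $\lambda_{\alpha,n}\simeq n^{\frac{2\alpha}{d_f}}$, i.e. there are constants $0<c\le C$ with $c\,n^{2\alpha/d_f}\le\lambda_{\alpha,n}\le C\,n^{2\alpha/d_f}$ for all $n$. Moreover, the eigenvalue $\lambda_{\alpha,0}=0$ is simple.
   Context: $(X,d)$ is a compact metric space and $\mu$ is a finite Borel measure on $X$ that is Ahlfors $d_f$-regular for some $d_f>0$: there is $C\ge 1$ with $C^{-1}r^{d_f}\le \mu(\overline B(x,r))\le Cr^{d_f}$ for all $x\in X$ and $0\le r<\operatorname{diam}X$. Hilbert spaces are real here. For $0<\alpha<1$ let $\mathcal H_\alpha=\{f\in L^2(X,\mu):\int_X\int_X\frac{|f(x)-f(y)|^2}{d(x,y)^{d_f+2\alpha}}d\mu(y)d\mu(x)<\infty\}$ and $\mathcal E_\alpha(f,g)=\frac12\int_X\int_X\frac{(f(x)-f(y))(g(x)-g(y))}{d(x,y)^{d_f+2\alpha}}d\mu(y)d\mu(x)$ on $\mathcal H_\alpha$. The $\alpha$-fractional Dirichlet Laplacian $\Delta_\alpha$ is the positive self-adjoint operator on $L^2(X,\mu)$ with $\operatorname{Dom}\Delta_\alpha^{1/2}=\mathcal H_\alpha$ and $\mathcal E_\alpha(f,g)=\langle\Delta_\alpha^{1/2}f,\Delta_\alpha^{1/2}g\rangle$. It has compact resolvent. *)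

(* Defs.v *)
From HB Require Import structures.
From mathcomp Require Import all_boot all_order all_algebra.
From mathcomp Require Import all_classical all_reals all_analysis.

Set Implicit Arguments.
Unset Strict Implicit.
Unset Printing Implicit Defensive.

Import Order.TTheory GRing.Theory Num.Theory.
Import numFieldNormedType.Exports.

Local Open Scope classical_set_scope.
Local Open Scope ring_scope.

(* A base point is required by [g_sigma_algebraType]; it only excludes the
   empty space. *)
#[short(type="pmetricType")]
HB.structure Definition PMetric (K : numDomainType) :=
  { M of Metric K M & Pointed M }.

Definition borel (R : realType) (X : pmetricType R) :=
  g_sigma_algebraType (@open X).

Section MetricMeasure.
Context (R : realType) (X : pmetricType R).

Definition diam : R := sup [set r | exists x y : X, r = mdist x y].

(* For [r = 0] the bounds read [mu [set x] = 0], since [0 `^ df = 0]. *)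
Definition ahlfors_regular (mu : set (borel X) -> \bar R) (df : R) : Prop :=
  exists2 C : R, 1 <= C &
    forall (x : X) (r : R), 0 <= r -> r < diam ->
      ((C^-1 * r `^ df)%:E <= mu [set y : X | (mdist x y <= r)%R])%E /\
      (mu [set y : X | (mdist x y <= r)%R] <= (C * r `^ df)%:E)%E.

End MetricMeasure.

Section Operators.
Context d (T : measurableType d) (R : realType).
Variable mu : {measure set T -> \bar R}.

(* Square-integrable functions, not quotiented: elements of L^2 are
   represented by functions, and equality in L^2 is [f = g %[ae mu]]. *)
Definition L2 := LfunType mu (lee1n 2).

Definition L2dot (f g : L2) : R := \int[mu]_x (f x * g x).

(* A possibly unbounded operator is given by its graph. *)
Definition op_graph := L2 -> L2 -> Prop.

Record linear_operator (A : op_graph) : Prop := LinearOperator {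
  op_ae : forall f f' h h' : L2,
    f = f' %[ae mu] -> h = h' %[ae mu] -> A f h -> A f' h' ;
  op_fun : forall f h h' : L2, A f h -> A f h' -> h = h' %[ae mu] ;
  op0 : A 0 0 ;
  op_lin : forall (a : R) (f f' h h' : L2),
    A f h -> A f' h' -> A (a *: f + f') (a *: h + h') }.

Definition Dom (A : op_graph) : set L2 := [set f | exists h, A f h].

Definition dense_in_L2 (V : set L2) : Prop :=
  forall (f : L2) (e : R), 0 < e ->
    exists2 g : L2, V g & ('N[mu]_2[EFin \o ((f - g)%R : L2)] < e%:E)%E.

(* The defining relation of the adjoint; it is the graph of an operator when
   [Dom A] is dense. *)
Definition adjoint (A : op_graph) : op_graph :=
  fun f h => forall u v : L2, A u v -> L2dot v f = L2dot u h.

Definition self_adjoint (A : op_graph) : Prop :=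
  [/\ linear_operator A, dense_in_L2 (Dom A) &
      forall f h : L2, A f h <-> adjoint A f h].

Definition positive_self_adjoint (A : op_graph) : Prop :=
  self_adjoint A /\ forall f h : L2, A f h -> 0 <= L2dot h f.

(* [S] is the square root of [A]: it is positive self-adjoint and
   [S \o S = A], including equality of domains. *)
Definition is_sqrt (A S : op_graph) : Prop :=
  positive_self_adjoint S /\
  forall f h : L2, A f h <-> exists2 g : L2, S f g & S g h.

Definition op_eigenspace (A : op_graph) (t : R) : set L2 := [set f | A f (t *: f)].

(* [V] has dimension [k] modulo equality almost everywhere. *)
Definition has_dim (V : set L2) (k : nat) : Prop :=
  exists phi : 'I_k -> L2,
    [/\ forall i, V (phi i),
        forall c : 'I_k -> R,
          (\sum_i c i *: phi i : L2) = (0 : L2) %[ae mu] ->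
          forall i, c i = 0 &
        forall f : L2, V f ->
          exists c : 'I_k -> R, f = (\sum_i c i *: phi i : L2) %[ae mu]].

(* [lam] lists all the eigenvalues of [A] in increasing order, each one
   repeated as many times as its multiplicity; taking [k = 0] covers the
   reals which are not eigenvalues. *)
Definition eigenvalue_sequence (A : op_graph) (lam : nat -> R) : Prop :=
  {homo lam : m n / (m <= n)%N >-> m <= n} /\
  forall t : R, exists2 k : nat,
    has_dim (op_eigenspace A t) k & ([set n | lam n = t] #= `I_k)%card.

End Operators.

Section DirichletLaplacian.
Context (R : realType) (X : pmetricType R).
Variable mu : {finite_measure set (borel X) -> \bar R}.
Variables df alpha : R.

(* On the diagonal the integrands below are [0] by the convention [0^-1 = 0];
   under Ahlfors regularity the diagonal is a null set when [0 < diam X]. *)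
Definition Halpha : set (L2 mu) :=
  [set f : L2 mu |
    (\int[mu]_x \int[mu]_y
       (`|f x - f y| ^+ 2 / mdist (x : X) (y : X) `^ (df + 2 * alpha))%:E
     < +oo)%E].

(* For [f] and [g] in [Halpha] the inner integral is finite for almost all
   [x] and the double integral is finite. *)
Definition Ealpha (f g : L2 mu) : R :=
  2^-1 * fine (\int[mu]_x \int[mu]_y
    ((f x - f y) * (g x - g y)
       / mdist (x : X) (y : X) `^ (df + 2 * alpha))%:E)%E.

Definition is_dirichlet_laplacian (A : op_graph mu) : Prop :=
  positive_self_adjoint A /\
  exists S : op_graph mu,
    [/\ is_sqrt A S, Dom S = Halpha &
        forall f g Sf Sg : L2 mu, S f Sf -> S g Sg ->
          Ealpha f g = L2dot Sf Sg].

End DirichletLaplacian.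

(* Main.v *)
Require Import Defs.
From HB Require Import structures.
From mathcomp Require Import all_boot all_order all_algebra finmap.
From mathcomp Require Import all_classical all_reals all_analysis.
From mathcomp Require Import measurable_realfun ring lra.

Set Implicit Arguments.
Unset Strict Implicit.
Unset Printing Implicit Defensive.

Import Order.TTheory GRing.Theory Num.Theory.
Import numFieldNormedType.Exports.

Local Open Scope classical_set_scope.
Local Open Scope ring_scope.

(**
  The eigenvalues are compared with the dimensions of two kinds of subspaces.
  - Lower bound: X is cut into at most about r^(-df) Voronoi cells of diameter
    at most 2r and measure at least about r^df. On each cell the variance of f
    is controlled by the Gagliardo energy, so the squared norm of f is at most
    about r^(2 alpha) times its energy, up to the squares of its means on the
    cells. In the span of more eigenvectors than there are cells, some nonzero
    f has zero mean on every cell.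
  - Upper bound: about r^(-df) tent functions of radius r with disjoint supports
    span a space on which the energy is at most about r^(-2 alpha) times the
    squared norm; the singular kernel is integrated over dyadic annuli.
  The first estimate also makes the embedding of the form domain in L^2 compact.
  Hence the energy attains its infimum on the unit sphere of the orthogonal
  complement of finitely many eigenvectors, and the minimizer is an eigenvector;
  this is what turns trial spaces into upper bounds. Constants are eigenvectors
  of eigenvalue 0, and the lower bound at n = 1 leaves no room for another one.
*)

(** * Positive semidefinite forms and self-adjoint graphs *)

(** No spectral theorem is invoked: about the spectrum only the list [lam] with its multiplicities
    is given. The lower bound needs nothing but the listed eigenvectors. For the upper bound, where
    an eigenbasis would be the usual tool, the argument is by contradiction: if [lam n] were too
    large, an energy minimizer would be an eigenvector missing from the list.

    Everything goes through the square root [S] of the operator. The energy of [f] is the squared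
    norm of its image under [S], and the identity of [S] with its adjoint gives both the closedness
    of the graph and the passage from a weak eigenvalue equation to a strong one.

    The scale [r] is tied to [n] by making [r ^ (-df)] comparable with [n], so that [r ^ (-2 alpha)]
    is comparable with [n ^ (2 alpha / df)].

    Regularity says nothing when the diameter is 0; this case is excluded beforehand by the infinite
    free family of eigenvectors. *)

Section PositiveForm.
Context (R : realType) (V : lmodType R) (dot : V -> V -> R).

(** Only semidefinite, because elements of [L2] are functions: [dot u u = 0] will mean that [u]
    vanishes almost everywhere. *)
Record psd_form : Prop := PsdForm {
  psd_sym : forall u v, dot u v = dot v u ;
  psd_linear : forall a u v w, dot (a *: u + v) w = a * dot u w + dot v w ;
  psd_ge0 : forall u, 0 <= dot u u }.

(** Completeness tested on geometrically fast Cauchy sequences only; the explicit rate makes the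
    increments summable when this is checked for [L2]. *)
Definition form_complete : Prop := forall f : nat -> V,
  (forall k j, (k <= j)%N -> dot (f j - f k) (f j - f k) <= (2^-1 ^+ k) ^+ 2) ->
  exists g, forall k, dot (g - f k) (g - f k) <= (2^-1 ^+ k) ^+ 2.

Hypothesis dotP : psd_form.

Lemma dot0l w : dot 0 w = 0.
Proof. by have := psd_linear dotP (-1) 0 0 w; rewrite scaler0 addr0; lra. Qed.

Lemma dotDl u v w : dot (u + v) w = dot u w + dot v w.
Proof. by have := psd_linear dotP 1 u v w; rewrite scale1r mul1r. Qed.

Lemma dotZl a u w : dot (a *: u) w = a * dot u w.
Proof. by have := psd_linear dotP a u 0 w; rewrite addr0 dot0l addr0. Qed.

Lemma dotBl u v w : dot (u - v) w = dot u w - dot v w.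
Proof. by rewrite dotDl -scaleN1r dotZl mulN1r. Qed.

Lemma dotDr u v w : dot w (u + v) = dot w u + dot w v.
Proof. by rewrite !(psd_sym dotP w) dotDl. Qed.

Lemma dotZr a u w : dot w (a *: u) = a * dot w u.
Proof. by rewrite !(psd_sym dotP w) dotZl. Qed.

Lemma dotBr u v w : dot w (u - v) = dot w u - dot w v.
Proof. by rewrite !(psd_sym dotP w) dotBl. Qed.

Lemma dot_suml I (r : seq I) (P : pred I) (F : I -> V) w :
  dot (\sum_(i <- r | P i) F i) w = \sum_(i <- r | P i) dot (F i) w.
Proof.
elim/big_rec2 : _ => [|i y x _ IH]; first exact: dot0l.
by rewrite dotDl IH.
Qed.

Lemma dot_sumr I (r : seq I) (P : pred I) (F : I -> V) w :
  dot w (\sum_(i <- r | P i) F i) = \sum_(i <- r | P i) dot w (F i).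
Proof. by rewrite psd_sym// dot_suml; apply: eq_bigr => i _; rewrite psd_sym. Qed.

Lemma cauchy_schwarz u v : dot u v ^+ 2 <= dot u u * dot v v.
Proof.
have q t : 0 <= dot u u + 2 * t * dot u v + t ^+ 2 * dot v v.
  have := psd_ge0 dotP (u + t *: v).
  rewrite dotDl !dotDr !dotZl !dotZr (psd_sym dotP v u); nra.
have [v0|v0] := eqVneq (dot v v) 0; last first.
  have vp : 0 < dot v v by rewrite lt_neqAle eq_sym v0 psd_ge0.
  have := q (- dot u v / dot v v).
  rewrite -(pmulr_rge0 _ vp).
  suff -> : dot v v * (dot u u + 2 * (- dot u v / dot v v) * dot u v +
      (- dot u v / dot v v) ^+ 2 * dot v v) = dot u u * dot v v - dot u v ^+ 2.
    by rewrite subr_ge0.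
  by field.
rewrite v0 mulr0; have [->|b0] := eqVneq (dot u v) 0; first by rewrite expr0n.
(* When [v] is null the quadratic is affine in [t]; this value of [t] would make it equal to
   [-1]. *)
have := q (- (dot u u + 1) / (2 * dot u v)); rewrite v0.
suff -> : dot u u + 2 * (- (dot u u + 1) / (2 * dot u v)) * dot u v +
   (- (dot u u + 1) / (2 * dot u v)) ^+ 2 * 0 = -1 by lra.
by field.
Qed.

Lemma dot_null u v : dot u u = 0 -> dot u v = 0.
Proof.
move=> u0; apply/eqP; rewrite -sqrf_eq0 eq_le sqr_ge0 andbT.
by rewrite (le_trans (cauchy_schwarz u v))// u0 mul0r.
Qed.

Lemma ler_norm_dot u v : `|dot u v| <= Num.sqrt (dot u u) * Num.sqrt (dot v v).
Proof.
rewrite -sqrtrM ?psd_ge0// -sqrtr_sqr ler_sqrt ?cauchy_schwarz//.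
by rewrite mulr_ge0// psd_ge0.
Qed.

Lemma form_parallelogram u v :
  dot (u - v) (u - v) = 2 * dot u u + 2 * dot v v - dot (u + v) (u + v).
Proof.
by rewrite dotBl !dotBr dotDl !dotDr (psd_sym dotP v u); lra.
Qed.

Section Limits.
Variables (x : V) (s : nat -> V).
Hypothesis sx : forall k, dot (x - s k) (x - s k) <= (2^-1 ^+ k) ^+ 2.

Let cvg_half (c : R) : (fun k => c * 2^-1 ^+ k) @ \oo --> (0 : R).
Proof.
by rewrite -(mulr0 c); apply: cvgZr; apply: cvg_expr; rewrite ger0_norm; lra.
Qed.

Lemma cvg_dotr v : dot v (s k) @[k --> \oo] --> dot v x.
Proof.
apply/cvgrPdist_le => e e0.
have /cvgrPdist_le/(_ _ e0) := cvg_half (Num.sqrt (dot v v)).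
apply: filterS => k; rewrite sub0r normrN => h.
rewrite -dotBr (le_trans (ler_norm_dot _ _))// (le_trans _ h)//.
rewrite (le_trans _ (ler_norm _))// ler_wpM2l ?sqrtr_ge0//.
rewrite -[leRHS]ger0_norm; last by rewrite exprn_ge0//; lra.
by rewrite -sqrtr_sqr ler_sqrt ?sqr_ge0.
Qed.

Lemma cvg_dotl v : dot (s k) v @[k --> \oo] --> dot x v.
Proof.
under eq_fun do rewrite psd_sym//.
by rewrite psd_sym//; exact: cvg_dotr.
Qed.

Lemma cvg_form : dot (s k) (s k) @[k --> \oo] --> dot x x.
Proof.
have -> : (fun k => dot (s k) (s k)) = (fun k =>
    dot x (s k) + dot (s k) x - dot x x + dot (x - s k) (x - s k)).
  by apply/funext => k; rewrite dotBl !dotBr; lra.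
rewrite [X in _ --> X](_ : _ = dot x x + dot x x - dot x x + 0); last lra.
apply: cvgD; last first.
  apply: (@squeeze_cvgr _ _ _ _ (cst 0) (fun k => 1 * 2^-1 ^+ k)) => //.
  - apply: nearW => k; rewrite psd_ge0//= mul1r (le_trans (sx k))//.
    rewrite expr2 ger_pMr ?exprn_gt0 ?invr_gt0 ?ltr0n//.
    by rewrite exprn_ile1//; lra.
  - exact: cvg_cst.
apply: (cvgB (cvgD (@cvg_dotr x) (@cvg_dotl x))); exact: cvg_cst.
Qed.

End Limits.

End PositiveForm.

Lemma fmap_ultra (T U : Type) (f : T -> U) (F : set_system T) :
  UltraFilter F -> UltraFilter (fmap f F).
Proof.
move=> FU; split => [|G FG sFG]; first exact: fmap_proper_filter.
apply/seteqP; split => // A GA.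
have [//|FnA] := in_ultra_setVsetC (f @^-1` A) FU.
have GnA : G (~` A) by exact: sFG.
have : G (A `&` ~` A) by exact: filterI.
by rewrite setICr => G0; have := @filter_not_empty _ G _ G0.
Qed.

(** Bounded real functions converge along an ultrafilter. This replaces the extraction of
    subsequences: finitely many functionals become almost constant on one common large set. *)
Lemma ultra_bounded_cauchy (R : realType) (T : Type) (F : set_system T)
    (f : T -> R) (M e : R) : UltraFilter F -> F [set x | `|f x| <= M] -> 0 < e ->
  exists2 A : set T, F A & forall x y, A x -> A y -> `|f x - f y| <= e.
Proof.
move=> FU FM e0.
have cM := @segment_compact R (- M) M; rewrite compact_ultra in cM.
have [] := cM (fmap f F).
- exact: fmap_ultra.
- rewrite /fmap/=; apply: filterS FM => x /=.
  by rewrite ler_norml in_itv.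
- move=> l [_ /cvgrPdist_le /(_ (e / 2))].
  rewrite divr_gt0// => /(_ isT) h.
  exists [set x | `|l - f x| <= e / 2]; first exact: h.
  move=> x y /= lx ly.
  have -> : f x - f y = (l - f y) - (l - f x) by ring.
  by rewrite (le_trans (ler_normB _ _))// [leRHS]splitr lerD.
Qed.

Lemma cvgn_unique (R : realType) (u : nat -> R) (a b : R) :
  u @ \oo --> a -> u @ \oo --> b -> a = b.
Proof. by move=> /(cvg_lim (@Rhausdorff R)) <- /(cvg_lim (@Rhausdorff R)) <-. Qed.

(** The first-order condition at a minimum: for [b] nonzero, a small multiple of [-b] would make the
    expression negative. *)
Lemma linear_le_quadratic0 (R : realFieldType) (b c : R) :
  (forall t, 0 <= 2 * t * b + t ^+ 2 * c) -> b = 0.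
Proof.
move=> h; apply/eqP; rewrite -sqrf_eq0 eq_le sqr_ge0 andbT.
have C0 : 0 < `|c| + 1 by rewrite ltr_wpDl.
have := h (- b / (`|c| + 1)).
have -> : 2 * (- b / (`|c| + 1)) * b + (- b / (`|c| + 1)) ^+ 2 * c =
  b ^+ 2 * (c - 2 * (`|c| + 1)) / (`|c| + 1) ^+ 2.
  by field; rewrite gt_eqF.
rewrite pmulr_lge0 ?invr_gt0 ?exprn_gt0//.
by have := ler_norm c; have := sqr_ge0 b; nra.
Qed.

Section SelfAdjointGraph.
Context (R : realType) (V : lmodType R) (dot : V -> V -> R).
Hypothesis dotP : psd_form dot.
Hypothesis dot_complete : form_complete dot.

Variable S : V -> V -> Prop.
(** From left to right this is symmetry. From right to left it is maximality: whatever satisfies the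
    relation weakly lies in the graph, so limits and weak solutions do. *)
Hypothesis S_adj : forall f h, S f h <-> (forall u v, S u v -> dot v f = dot u h).

Lemma graph_sym f h u v : S f h -> S u v -> dot v f = dot u h.
Proof. by move=> /S_adj; exact. Qed.

Lemma graph0 : S 0 0.
Proof. by apply/S_adj => u v _; rewrite !(psd_sym dotP _ 0) !dot0l. Qed.

Lemma graphP a f f' h h' : S f h -> S f' h' -> S (a *: f + f') (a *: h + h').
Proof.
move=> fh fh'; apply/S_adj => u v uv.
by rewrite !(dotDr dotP, dotZr dotP) (graph_sym fh uv) (graph_sym fh' uv).
Qed.

Lemma graph_sum I (r : seq I) (P : pred I) (c : I -> R) (F G : I -> V) :
  (forall i, S (F i) (G i)) ->
  S (\sum_(i <- r | P i) c i *: F i) (\sum_(i <- r | P i) c i *: G i).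
Proof.
move=> FG; elim: r => [|i r IH]; first by rewrite !big_nil; exact: graph0.
by rewrite !big_cons; case: ifP => // _; exact: graphP.
Qed.

(** Eigenvectors of [S] composed with [S], the operator whose square root is [S]. *)
Definition eigvec (t : R) (f : V) := exists2 g, S f g & S g (t *: f).

Lemma eigvec_energy t f f' g g' : S f f' -> S f' (t *: f) -> S g g' ->
  dot f' g' = t * dot f g.
Proof.
move=> ff' f't gg'; by rewrite (psd_sym dotP) (graph_sym f't gg') (dotZr dotP) (psd_sym dotP g).
Qed.

Lemma eigvec_orth s t f g : eigvec s f -> eigvec t g -> s != t -> dot f g = 0.
Proof.
move=> [f' ff' f't] [g' gg' g't] st.
have h1 := eigvec_energy ff' f't gg'.
have := eigvec_energy gg' g't ff'; rewrite (psd_sym dotP g') h1 (psd_sym dotP g) => h2.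
have /eqP : (s - t) * dot f g = 0 by rewrite mulrBl h2 subrr.
by rewrite mulf_eq0 subr_eq0 (negbTE st) => /eqP.
Qed.

(* A quantitative form of compactness: up to [e] times the energy, the norm is
   controlled by finitely many linear functionals. *)
Definition compact_embedding := forall e, 0 < e -> exists s : seq V,
  forall f f', S f f' ->
    dot f f <= e * dot f' f' + \sum_(w <- s) dot f w ^+ 2.

(** The direct method. Along an ultrafilter of near-minimizers, the compact embedding gives the
    Cauchy property for the vectors and then for their images; completeness provides both limits,
    and the adjoint relation shows that they form a pair of the graph. *)
Lemma energy_minimizer (k : nat) (psi : 'I_k -> V) :
  compact_embedding ->
  (exists f f', [/\ S f f', forall i, dot f (psi i) = 0 & 0 < dot f f]) ->
  exists f f', [/\ S f f', forall i, dot f (psi i) = 0, dot f f = 1 &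
    forall g g', S g g' -> (forall i, dot g (psi i) = 0) ->
      dot f' f' * dot g g <= dot g' g'].
Proof.
move=> cpt [f0 [f0' [f0S f0psi f0_gt0]]].
pose W (p : V * V) := S p.1 p.2 /\ forall i, dot p.1 (psi i) = 0.
pose E := [set dot p.2 p.2 | p in [set p | W p /\ dot p.1 p.1 = 1]].
have W_norm g g' : S g g' -> (forall i, dot g (psi i) = 0) -> 0 < dot g g ->
    E (dot g' g' / dot g g).
  move=> gg' gpsi g_gt0.
  pose a := (Num.sqrt (dot g g))^-1.
  have a2 : a ^+ 2 = (dot g g)^-1 by rewrite exprVn sqr_sqrtr// ltW.
  exists (a *: g, a *: g') => /=; first split; first split => /=.
  - by have := graphP a gg' graph0; rewrite !addr0.
  - by move=> i; rewrite dotZl// gpsi mulr0.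
  - by rewrite dotZl// dotZr// mulrA -expr2 a2 mulVf// gt_eqF.
  - by rewrite dotZl// dotZr// mulrA -expr2 a2 mulrC.
have infE : has_inf E.
  split; first by exists (dot f0' f0' / dot f0 f0); exact: W_norm.
  by exists 0 => _ [p _ <-]; rewrite psd_ge0.
set m := inf E.
have mE g g' : S g g' -> (forall i, dot g (psi i) = 0) ->
    m * dot g g <= dot g' g'.
  move=> gg' gpsi; have := psd_ge0 dotP g; rewrite le_eqVlt => /orP[/eqP <-|g0].
    by rewrite mulr0 psd_ge0.
  by rewrite -ler_pdivlMr//; apply: (inf_lbound infE.2); exact: W_norm.
(* Unit vectors whose energy exceeds the infimum by less than [n]; these sets form a filter base. *)
pose B (n : R) := [set p : V * V |
  [/\ W p, dot p.1 p.1 = 1 & dot p.2 p.2 < m + n]].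
have FB : ProperFilter (filter_from [set n : R | 0 < n] B).
  apply: filter_from_proper; last first.
    move=> n n0; have [_ [p [Wp p1] <-] hp] := inf_adherent n0 infE.
    by exists p.
  apply: filter_from_filter; first by exists 1 => /=.
  move=> i j i0 j0; exists (Num.min i j); first by rewrite /= lt_min i0.
  move=> p [Wp p1 p2]; split; split => //; apply: (lt_le_trans p2).
    by rewrite lerD2l ge_min lexx.
  by rewrite lerD2l ge_min lexx orbT.
have [U [UU sFU]] := ultraFilterLemma FB.
have UB n : 0 < n -> U (B n) by move=> n0; apply: sFU; exists n.
have Ucoef (s : seq V) e : 0 < e -> exists2 A, U A & forall p q, A p -> A q ->
    \sum_(w <- s) dot (p.1 - q.1) w ^+ 2 <= e.
  elim: s e => [|w s IH] e e0.
    exists setT; first exact: filterT.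
    by move=> p q _ _; rewrite big_nil ltW.
  have [A UA hA] := IH (e / 2) (divr_gt0 e0 (ltr0Sn _ _)).
  have h : U [set p : V * V | `|dot p.1 w| <= Num.sqrt (dot w w)].
    apply: filterS (UB 1 ltr01) => p [_ p1 _] /=.
    by rewrite (le_trans (ler_norm_dot dotP _ _))// p1 sqrtr1 mul1r.
  have se : 0 < Num.sqrt (e / 2) by rewrite sqrtr_gt0 divr_gt0.
  have [A' UA' hA'] := ultra_bounded_cauchy (UU) h se.
  exists (A `&` A'); first exact: filterI.
  move=> p q [Ap A'p] [Aq A'q]; rewrite big_cons [leRHS]splitr lerD ?hA//.
  rewrite dotBl// -real_normK ?num_real//.
  rewrite -[leRHS]sqr_sqrtr ?divr_ge0 ?(ltW e0)//.
  by rewrite lerXn2r ?nnegrE ?sqrtr_ge0//; exact: hA'.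
have m_ge0 : 0 <= m by apply: lb_le_inf infE.1 _ => _ [p _ <-]; rewrite psd_ge0.
(* Near-minimizers which are close in [V] are close in energy by the
   parallelogram identity. *)
have Ucauchy d : 0 < d -> exists2 A, U A & forall p q, A p -> A q ->
    dot (p.1 - q.1) (p.1 - q.1) <= d /\ dot (p.2 - q.2) (p.2 - q.2) <= d.
  move=> d0.
  (* The energy of the difference will be at most [4 * n + m * d']: the parallelogram identity
     bounds it by [4 * (m + n)] minus [m] times the squared norm of [p.1 + q.1], which is at least
     [4 - d']. Hence the choices of [d'] and of [n]. *)
  pose d' := Num.min (d / 2) (d / (2 * (m + 1))).
  have m1 : 0 < m + 1 by lra.
  have d'0 : 0 < d' by rewrite lt_min !divr_gt0//; lra.
  have d'd : d' <= d / 2 by rewrite ge_min lexx.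
  have d'm : m * d' <= d / 2.
    have -> : d / 2 = (m + 1) * (d / (2 * (m + 1))).
      by field; rewrite gt_eqF.
    by apply: ler_pM => //; rewrite ?(ltW d'0) ?ge_min ?lexx ?orbT//; lra.
  pose n := Num.min 1 (d / 8).
  have n0 : 0 < n by rewrite lt_min ltr01 divr_gt0.
  (* Near-minimizers have energy below [m + 1], so their difference has energy at most
     [4 * (m + 1)], and [e] times this is [d' / 2]. *)
  pose e := d' / (2 * (4 * (m + 1))).
  have e0 : 0 < e by rewrite divr_gt0//; lra.
  have [s hs] := cpt _ e0.
  have [A UA hA] := Ucoef s (d' / 2) (divr_gt0 d'0 (ltr0Sn _ _)).
  exists (A `&` B n); first by apply: filterI => //; exact: UB.
  move=> p q [Ap [[Sp Wp] p1 p2]] [Aq [[Sq Wq] q1 q2]].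
  have n1 : n <= 1 by rewrite ge_min lexx.
  have n8 : n <= d / 8 by rewrite ge_min lexx orbT.
  have Spq : S (p.1 - q.1) (p.2 - q.2).
    have := graphP (-1) Sq Sp.
    by rewrite !scaleN1r (addrC (- q.1)) (addrC (- q.2)).
  have Spq' : S (p.1 + q.1) (p.2 + q.2).
    by have := graphP 1 Sp Sq; rewrite !scale1r.
  have Epq := form_parallelogram dotP p.2 q.2.
  have Dpq := form_parallelogram dotP p.1 q.1.
  have /(mE _ _ Spq') mpq : forall i, dot (p.1 + q.1) (psi i) = 0.
    by move=> i; rewrite dotDl// Wp Wq addr0.
  have Epos := psd_ge0 dotP (p.2 + q.2).
  have dpq : dot (p.1 - q.1) (p.1 - q.1) <= d'.
    rewrite (le_trans (hs _ _ Spq))// [leRHS]splitr lerD ?hA//.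
    have -> : d' / 2 = e * (4 * (m + 1)).
      by rewrite /e; field; rewrite gt_eqF.
    rewrite ler_pM2l//; lra.
  split; first lra.
  by rewrite Epq; nra.
have e2 n : 0 < (2^-1 ^+ n) ^+ 2 :> R by rewrite !exprn_gt0// invr_gt0.
have [A UA] := choice (fun k =>
  let: ex_intro2 A UA hA := Ucauchy _ (e2 k) in ex_intro _ A (conj UA hA)).
(* [p n] is taken in all of [A 0, ..., A n], so that [p n] and every later term lie in [A n]. *)
have [p hp] : exists p : nat -> V * V, forall n,
    B ((2^-1 ^+ n)) (p n) /\ forall i, (i <= n)%N -> A i (p n).
  suff /choice[p hp] : forall n, exists p,
    B (2^-1 ^+ n) p /\ forall i, (i <= n)%N -> A i p by exists p.
  move=> n; apply: (@filter_ex _ U); apply: filterI.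
    by apply: UB; rewrite exprn_gt0// invr_gt0.
  elim: n => [|n IH].
    by apply: filterS (UA 0%N).1 => q Aq i; rewrite leqn0 => /eqP ->.
  apply: filterS2 IH (UA n.+1).1 => q IH Aq i.
  by rewrite leq_eqVlt => /orP[/eqP ->//|]; exact: IH.
have [f hf] : exists f, forall n, dot (f - (p n).1) (f - (p n).1) <= (2^-1 ^+ n) ^+ 2.
  apply: dot_complete => n j nj.
  by apply: (proj1 ((UA n).2 (p j) (p n) _ _)); apply: (hp _).2.
have [f' hf'] : exists f', forall n,
    dot (f' - (p n).2) (f' - (p n).2) <= (2^-1 ^+ n) ^+ 2.
  apply: dot_complete => n j nj.
  by apply: (proj2 ((UA n).2 (p j) (p n) _ _)); apply: (hp _).2.
(* The adjoint relation is continuous in both arguments, so it passes to the limit. *)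
have Sff' : S f f'.
  apply/S_adj => u v uv.
  apply: cvgn_unique (cvg_dotr dotP hf (v := v)) _.
  rewrite (_ : (fun n => dot v (p n).1) = (fun n => dot u (p n).2)).
    exact: cvg_dotr.
  apply/funext => n; case: (hp n) => -[[Sp _] _ _] _.
  exact: graph_sym Sp uv.
have f1 : dot f f = 1.
  apply: cvgn_unique (cvg_form dotP hf) _.
  rewrite (_ : (fun n => _) = cst 1); first exact: cvg_cst.
  by apply/funext => n; case: (hp n).1.
have fpsi i : dot f (psi i) = 0.
  apply: cvgn_unique (cvg_dotl dotP hf (v := psi i)) _.
  rewrite (_ : (fun n => _) = cst 0); first exact: cvg_cst.
  by apply/funext => n; case: (hp n) => -[[_ Wp] _ _] _.
have fm : dot f' f' <= m.
  apply: (ler_cvg_to (cvg_form dotP hf') (g := fun n => m + 2^-1 ^+ n) (l' := m)).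
  - rewrite -[X in _ --> X]addr0; apply: cvgD; first exact: cvg_cst.
    by apply: cvg_expr; rewrite ger0_norm; lra.
  - by apply: nearW => n; case: (hp n).1 => _ _ /ltW.
exists f, f'; split => // g g' gg' gpsi.
by rewrite (le_trans _ (mE _ _ gg' gpsi))// ler_wpM2r// psd_ge0.
Qed.
End SelfAdjointGraph.

(** * Eigenvalue bounds by dimension counting *)

Lemma exists_nonzero_kernel (F : fieldType) (n k : nat) (a : 'I_n -> 'I_k -> F) :
  (k < n)%N -> exists2 c : 'I_n -> F, (exists i, c i != 0) &
    forall j, \sum_i c i * a i j = 0.
Proof.
move=> kn; pose M := \matrix_(i, j) a i j.
have : kermx M != 0.
  rewrite -mxrank_eq0 mxrank_ker subn_eq0 -ltnNge.
  exact: leq_ltn_trans (rank_leq_col M) kn.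
move=> /rowV0Pn[v /sub_kermxP vM /rV0Pn[i vi]].
exists (fun i => v 0 i); first by exists i.
move=> j; have /rowP/(_ j) := vM; rewrite [LHS]mxE mxE => vMj.
by rewrite -[RHS]vMj; apply: eq_bigr => l _; rewrite mxE.
Qed.

Section Eigenvalues.
Context (R : realType) (V : lmodType R) (dot : V -> V -> R).
Hypothesis dotP : psd_form dot.
Hypothesis dot_complete : form_complete dot.
(** Gram-Schmidt by induction on [k]. That [e] is a combination of the [psi i] is recorded through
    orthogonality and through an arbitrary linear property [P], not by coefficients; [P] will say
    that [e] is in the domain of [S] and that its image is orthogonal to a given vector. *)
Lemma exists_projection (P : V -> Prop) (psi : nat -> V) (k : nat) :
  P 0 -> (forall a x y, P x -> P y -> P (a *: x + y)) ->
  (forall i, (i < k)%N -> P (psi i)) -> forall g, exists e, [/\ P e,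
    forall v, (forall i, (i < k)%N -> dot v (psi i) = 0) -> dot v e = 0 &
    forall i, (i < k)%N -> dot (g - e) (psi i) = 0].
Proof.
move=> P0 PD; elim: k => [_ g|k IH Ppsi g].
  by exists 0; split => // v _; rewrite (psd_sym dotP) dot0l.
have {}IH := IH (fun i ik => Ppsi i (ltnW ik)).
have [p [Pp op hp]] := IH (psi k); have [e [Pe oe he]] := IH g.
set x := psi k - p in hp.
have x_psi u : (forall i, (i < k)%N -> dot u (psi i) = 0) ->
    dot u (psi k) = dot u x.
  by move=> u0; rewrite (dotBr dotP) (op u u0) subr0.
(* A null residual means that [psi k] depends on its predecessors up to a null vector, and nothing
   has to be added. *)
have [x0|x0] := eqVneq (dot x x) 0.
  exists e; split => //.
    by move=> v hv; apply: oe => i ik; apply: hv; exact: ltnW.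
  move=> i; rewrite ltnS leq_eqVlt => /orP[/eqP ->|]; last exact: he.
  by rewrite x_psi// (psd_sym dotP) (dot_null dotP).
pose t := dot (g - e) x / dot x x.
have he' i : (i < k)%N -> dot (g - (t *: x + e)) (psi i) = 0.
  move=> ik; rewrite opprD addrCA addrC (dotBl dotP) he// (dotZl dotP) hp//.
  by rewrite mulr0 subr0.
exists (t *: x + e); split.
- apply: (PD) => //; rewrite /x addrC -scaleN1r; apply: PD => //.
  exact: Ppsi.
- move=> v hv; have hv' i : (i < k)%N -> dot v (psi i) = 0.
    by move=> ik; apply: hv; exact: ltnW.
  rewrite (dotDr dotP) (oe _ hv') addr0 (dotZr dotP) -x_psi//.
  by rewrite hv// mulr0.
- move=> i; rewrite ltnS leq_eqVlt => /orP[/eqP ->|]; last exact: he'.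
  rewrite x_psi// opprD addrCA addrC (dotBl dotP) (dotZl dotP) /t.
  by rewrite divfK// subrr.
Qed.

Variable S : V -> V -> Prop.
Hypothesis S_adj : forall f h, S f h <-> (forall u v, S u v -> dot v f = dot u h).

Let S_sum := graph_sum dotP S_adj.

(* [enum_span] says, in terms of orthogonality, that the [psi n] with
   [lam n = t] span the eigenspace of [t]. *)
Record eigen_enum (lam : nat -> R) (psi : nat -> V) : Prop := EigenEnum {
  enum_eig : forall n, eigvec S (lam n) (psi n) ;
  enum_free : forall n (c : 'I_n -> R),
    dot (\sum_i c i *: psi i) (\sum_i c i *: psi i) = 0 -> forall i, c i = 0 ;
  enum_span : forall t f, eigvec S t f ->
    (forall n, lam n = t -> dot f (psi n) = 0) -> dot f f = 0 }.

Lemma eigvec_choice lam (psi : nat -> V) : (forall n, eigvec S (lam n) (psi n)) ->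
  exists psi' : nat -> V,
    forall n, S (psi n) (psi' n) /\ S (psi' n) (lam n *: psi n).
Proof.
move=> eig; suff /choice[g hg] : forall n, exists g,
  S (psi n) g /\ S g (lam n *: psi n) by exists g.
by move=> n; have [g] := eig n; exists g.
Qed.

(** Some nonzero combination of the [n + 1] vectors [psi 0, ..., psi n] is orthogonal to the
    [k <= n] vectors [w i]. Its energy is at most [lam n] times its squared norm, so [hw] bounds the
    squared norm by [e * lam n] times itself. *)
Lemma eigenvalue_lower_bound lam psi (n k : nat) (w : 'I_k -> V) e :
  eigen_enum lam psi -> {homo lam : m n / (m <= n)%N >-> m <= n} ->
  (k <= n)%N -> 0 < e ->
  (forall f f', S f f' ->
    dot f f <= e * dot f' f' + \sum_i dot f (w i) ^+ 2) ->
  1 <= e * lam n.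
Proof.
move=> [eig free _] lam_homo kn e0 hw.
have [psi' hpsi] := eigvec_choice eig.
have [c [i0 ci0] hc] : exists2 c : 'I_n.+1 -> R, (exists i, c i != 0) &
    forall j, \sum_i c i * dot (psi i) (w j) = 0.
  by apply: exists_nonzero_kernel; rewrite ltnS.
pose f := \sum_i c i *: psi i; pose f' := \sum_i c i *: psi' i.
have Sf : S f f' by apply: S_sum => i; exact: (hpsi i).1.
have f_gt0 : 0 < dot f f.
  rewrite lt_neqAle psd_ge0// andbT; apply/eqP => /esym/free/(_ i0)/eqP.
  by rewrite (negbTE ci0).
have energy : dot f' f' <= lam n * dot f f.
  (* As eigenvectors of distinct eigenvalues are orthogonal, the difference
     of the two sides is a square. *)
  pose s (i : 'I_n.+1) := Num.sqrt (lam n - lam i).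
  have -> : lam n * dot f f = dot f' f' +
      dot (\sum_i (s i * c i) *: psi i) (\sum_i (s i * c i) *: psi i).
    rewrite /f /f' !(dot_suml dotP) mulr_sumr -big_split/=; apply: eq_bigr => i _.
    rewrite !(dot_sumr dotP) mulr_sumr -big_split/=; apply: eq_bigr => j _.
    rewrite !(dotZl dotP) !(dotZr dotP).
    have [Si Si'] := hpsi i; have [Sj _] := hpsi j.
    rewrite (eigvec_energy dotP S_adj Si Si' Sj).
    have [lij|lij] := eqVneq (lam i) (lam j); last first.
      by rewrite (eigvec_orth dotP S_adj (eig i) (eig j) lij); ring.
    have : s i * s j = lam n - lam i.
      rewrite /s -lij -expr2 sqr_sqrtr// subr_ge0 lam_homo//.
      by rewrite -ltnS.
    move=> sij; rewrite (_ : s i * c i * (s j * c j * dot (psi i) (psi j)) =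
      s i * s j * (c i * c j * dot (psi i) (psi j))); last by ring.
    by rewrite sij; ring.
  by rewrite lerDl psd_ge0.
have := hw _ _ Sf; rewrite [X in _ + X]big1; last first.
  move=> j _; rewrite (dot_suml dotP); under eq_bigr do rewrite dotZl//.
  by rewrite hc expr0n.
rewrite addr0 => h; rewrite -(ler_pM2r f_gt0) mul1r (le_trans h)//.
by rewrite -mulrA ler_wpM2l// ltW.
Qed.

(** Suppose [L < lam n]. The [n + 1] trial vectors span a space that meets the orthogonal complement
    of [psi i], [i < n], so the minimal energy [m] there is at most [L]. The minimizer is an
    eigenvector of [m]; as [m < lam n], all listed eigenvectors of [m] have index below [n], and it
    is orthogonal to them, against [enum_span]. *)
Lemma eigenvalue_upper_bound lam psi (n : nat) (u u' : 'I_n.+1 -> V) L :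
  eigen_enum lam psi -> {homo lam : m n / (m <= n)%N >-> m <= n} ->
  compact_embedding dot S ->
  (forall i, S (u i) (u' i)) ->
  (forall c : 'I_n.+1 -> R, (exists i, c i != 0) ->
    0 < dot (\sum_i c i *: u i) (\sum_i c i *: u i) /\
    dot (\sum_i c i *: u' i) (\sum_i c i *: u' i) <=
      L * dot (\sum_i c i *: u i) (\sum_i c i *: u i)) ->
  lam n <= L.
Proof.
move=> [eig _ span] lam_homo cpt uS hu; rewrite leNgt; apply/negP => Llam.
have [c c0 hc] : exists2 c : 'I_n.+1 -> R, (exists i, c i != 0) &
    forall j : 'I_n, \sum_i c i * dot (u i) (psi j) = 0.
  exact: exists_nonzero_kernel.
have [u_gt0 uL] := hu c c0.
have Su := S_sum (index_enum _) predT c uS.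
have u_psi (j : 'I_n) : dot (\sum_i c i *: u i) (psi j) = 0.
  by rewrite (dot_suml dotP); under eq_bigr do rewrite dotZl//; exact: hc.
have [f [f' [Sf fpsi f1 fmin]]] : exists f f', [/\ S f f',
    forall i : 'I_n, dot f (psi i) = 0, dot f f = 1 &
    forall g g', S g g' -> (forall i : 'I_n, dot g (psi i) = 0) ->
      dot f' f' * dot g g <= dot g' g'].
  apply: energy_minimizer => //.
  by exists (\sum_i c i *: u i), (\sum_i c i *: u' i).
set m := dot f' f' in fmin.
have mL : m <= L.
  by rewrite -(ler_pM2r u_gt0) (le_trans _ uL)// fmin.
(* The Euler-Lagrange equation, from the variation [f + t *: g] within the complement. *)
have orth g g' : S g g' -> (forall i : 'I_n, dot g (psi i) = 0) ->
    dot f' g' = m * dot f g.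
  move=> Sg gpsi; apply/eqP; rewrite -subr_eq0; apply/eqP.
  apply: (@linear_le_quadratic0 _ _ (dot g' g' - m * dot g g)) => t.
  have := fmin (t *: g + f) (t *: g' + f') (graphP dotP S_adj t Sg Sf) _.
  rewrite !(dotDl dotP, dotDr dotP, dotZl dotP, dotZr dotP) f1 -/m.
  rewrite (psd_sym dotP g f) (psd_sym dotP g' f') => h.
  have {}h := h _; have : forall i : 'I_n, dot (t *: g + f) (psi i) = 0.
    by move=> i; rewrite (dotDl dotP) (dotZl dotP) gpsi fpsi mulr0 addr0.
  by move=> /h; lra.
have [psi' hpsi] := eigvec_choice eig.
(* Subtracting projections extends the Euler-Lagrange equation [orth] from the
   complement of the [psi i] to all of [Dom S]. *)
have proj g : exists e, (exists2 e', S e e' & dot f' e' = 0) /\ dot f e = 0 /\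
    forall i, (i < n)%N -> dot (g - e) (psi i) = 0.
  have [||i ni|e [Pe oe ge]] := @exists_projection (fun e => exists2 e', S e e' &
      dot f' e' = 0) psi n _ _ _ g.
  - by exists 0; [exact: (graph0 dotP S_adj)|rewrite (psd_sym dotP) dot0l].
  - move=> a x y [x' Sx fx] [y' Sy fy]; exists (a *: x' + y').
      exact: (graphP dotP S_adj).
    by rewrite (dotDr dotP) (dotZr dotP) fx fy mulr0 addr0.
  - exists (psi' i); first exact: (hpsi i).1.
    rewrite (psd_sym dotP) (eigvec_energy dotP S_adj (hpsi i).1 (hpsi i).2 Sf).
    by rewrite (psd_sym dotP) (fpsi (Ordinal ni)) mulr0.
  - exists e; split => //; split => //; apply: oe => i ni.
    exact: (fpsi (Ordinal ni)).
have eigf : eigvec S m f.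
  exists f' => //; apply/S_adj => g g' Sg.
  have [e [[e' Se fe'] [fe ge]]] := proj g.
  have Sge : S (g - e) (g' - e').
    have := graphP dotP S_adj (-1) Se Sg.
    by rewrite !scaleN1r (addrC (- e)) (addrC (- e')).
  have : dot f' (g' - e') = m * dot f (g - e).
    by apply: orth => // i; apply: ge.
  rewrite !(dotBr dotP) fe fe' (dotZr dotP) (psd_sym dotP g) (psd_sym dotP g'); lra.
(* If [lam j = m], then [lam j <= L < lam n], and monotonicity forces [j < n]. *)
have : dot f f = 0.
  apply: span eigf _ => j lamj.
  suff jn : (j < n)%N by exact: (fpsi (Ordinal jn)).
  by rewrite ltnNge; apply/negP => /lam_homo; rewrite lamj; lra.
by rewrite f1 => /eqP; rewrite oner_eq0.
Qed.

Definition eigspace_basis (t : R) (k : nat) (phi : 'I_k -> V) :=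
  [/\ forall i, eigvec S t (phi i),
      forall c : 'I_k -> R,
        dot (\sum_i c i *: phi i) (\sum_i c i *: phi i) = 0 -> forall i, c i = 0 &
      forall f, eigvec S t f -> exists c : 'I_k -> R,
        dot (f - \sum_i c i *: phi i) (f - \sum_i c i *: phi i) = 0].

(** The equality of cardinals is used as a bijection [e] that transports the basis to the indices
    [n] with [lam n = t]. *)
Lemma eigspace_basis_reindex (lam : nat -> R) t k (phi : 'I_k -> V) :
  eigspace_basis t phi -> ([set n | lam n = t] #= `I_k)%card ->
  exists P : nat -> V, [/\ forall n, lam n = t -> eigvec S t (P n),
    forall N (c : 'I_N -> R),
      let s := \sum_(i < N | lam i == t) c i *: P i in
      dot s s = 0 -> forall i : 'I_N, lam i = t -> c i = 0 &
    forall f, eigvec S t f -> (forall n, lam n = t -> dot f (P n) = 0) ->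
      dot f f = 0].
Proof.
move=> [eig free span] /card_set_bijP[e [e_fun e_inj e_surj]].
(* The default [0] can occur only when [lam n] differs from [t]. *)
pose P n := if insub (e n) is Some j then phi j else 0.
have PE n (j : 'I_k) : e n = j -> P n = phi j by move=> enj; rewrite /P enj valK.
exists P; split.
- move=> n nt; have en : (e n < k)%N := e_fun n nt.
  by rewrite (PE n (Ordinal en))//; exact: eig.
- move=> N c /= s0 i0 i0t.
  (* Coefficients pushed forward along [e]; each sum has at most one term, and none for basis
     vectors whose index is [N] or more. *)
  pose c' (j : 'I_k) := \sum_(i < N | (lam i == t) && (e i == j)) c i.
  have c'E : \sum_j c' j *: phi j = \sum_(i < N | lam i == t) c i *: P i.
    under eq_bigr do rewrite scaler_suml.
    rewrite (exchange_big_dep (fun i : 'I_N => lam i == t))/=; last first.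
      by move=> i j _ /andP[].
    apply: eq_bigr => i /[dup] it /eqP lamt.
    have en : (e i < k)%N := e_fun i lamt.
    rewrite (PE i (Ordinal en))// (big_pred1 (Ordinal en))// => j.
    by rewrite it /= eq_sym.
  have en : (e i0 < k)%N := e_fun i0 i0t.
  rewrite -c'E in s0; have := free _ s0 (Ordinal en).
  rewrite /c' (big_pred1 i0)// => i /=.
  apply/andP/eqP => [[/eqP it /eqP ei]|->]; last by rewrite i0t !eqxx.
  by apply: val_inj; apply: e_inj; rewrite ?inE.
- move=> f ef fP; have [c hc] := span f ef.
  have f_phi j : dot f (phi j) = 0.
    have [n nt en] := e_surj j (ltn_ord j).
    by rewrite -(PE n)//; exact: fP.
  rewrite -[X in dot _ X](subrK (\sum_i c i *: phi i)) (dotDr dotP).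
  rewrite (psd_sym dotP f) (dot_null dotP)// add0r (dot_sumr dotP).
  by rewrite big1// => j _; rewrite (dotZr dotP) f_phi mulr0.
Qed.

(** Bases of the various eigenspaces are glued together. Freeness reduces to one eigenspace at a
    time, since different eigenspaces are orthogonal. *)
Lemma eigen_enum_exists (lam : nat -> R) :
  (forall t, exists2 k, exists phi : 'I_k -> V, eigspace_basis t phi &
    ([set n | lam n = t] #= `I_k)%card) ->
  exists psi, eigen_enum lam psi.
Proof.
move=> H.
have /choice[P hP] := fun t => let: ex_intro2 k (ex_intro phi hphi) hk := H t in
  eigspace_basis_reindex hphi hk.
pose psi n := P (lam n) n.
have eig n : eigvec S (lam n) (psi n) by have [h _ _] := hP (lam n); exact: h.
exists psi; split => //.
- move=> N c s0 i0; have [_ free _] := hP (lam i0).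
  apply: (free N c) => //=; set s := \sum_(i < N | _) _.
  have sE : s = \sum_(i < N | lam i == lam i0) c i *: psi i.
    by apply: eq_bigr => i /eqP lii0; rewrite /psi lii0.
  (* The rest of the combination is orthogonal to [s], and the whole combination is null. *)
  have -> : dot s s = dot (\sum_i c i *: psi i) s; last by rewrite (dot_null dotP).
  rewrite [in RHS](bigID (fun i : 'I_N => lam i == lam i0))/= -sE (dotDl dotP).
  rewrite [X in _ + X](_ : _ = 0) ?addr0// sE (dot_suml dotP) big1// => i li.
  rewrite (dot_sumr dotP) big1// => j /eqP lj.
  rewrite (dotZl dotP) (dotZr dotP) (eigvec_orth dotP S_adj (eig i) (eig j)) ?mulr0//.
  by rewrite lj.
- move=> t f ef fpsi; have [_ _ span] := hP t; apply: span => // n nt.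
  by have := fpsi n nt; rewrite /psi nt.
Qed.
End Eigenvalues.

(** * Square-integrable functions *)

Lemma nneseries_geometric_le (R : realType) (u : nat -> \bar R) (a q : R) :
  0 <= a -> 0 <= q -> q < 1 -> (forall n, 0 <= u n)%E ->
  (forall n, u n <= (a * q ^+ n)%:E)%E ->
  (\sum_(0 <= n <oo) u n <= (a / (1 - q))%:E)%E.
Proof.
move=> a0 q0 q1 u0 uaq; have q1' : 0 < 1 - q by lra.
apply: lime_le; first exact: is_cvg_nneseries.
apply: nearW => n.
suff sumE : (\sum_(0 <= k < n) u k <= (a * (1 - q ^+ n) / (1 - q))%:E)%E.
  rewrite (le_trans sumE)// lee_fin ler_pM2r ?invr_gt0//.
  by have := exprn_ge0 n q0; nra.
elim: n => [|n IH]; first by rewrite big_nil expr0 subrr mulr0 mul0r.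
rewrite big_nat_recr//= (le_trans (leeD IH (uaq n)))// -EFinD lee_fin.
rewrite le_eqVlt; apply/orP; left; apply/eqP.
by rewrite exprS; field; rewrite gt_eqF.
Qed.

Lemma limn_einf_le (R : realType) (u : nat -> \bar R) (c : \bar R) :
  (forall n, u n <= c)%E -> (limn_einf u <= c)%E.
Proof.
move=> uc; rewrite limn_einf_lim; apply: lime_le; first exact: is_cvg_einfs.
apply: nearW => n; apply: (le_trans _ (uc n)).
by apply: ereal_inf_lbound; exists n => /=.
Qed.

Section L2Space.
Context d (T : measurableType d) (R : realType).
Variable mu : {finite_measure set T -> \bar R}.
Implicit Types f g h : L2 mu.

Lemma measurable_L2 f : measurable_fun setT f.
Proof. exact: measurable_funPT. Qed.

Lemma L2_mul_integrable f g : mu.-integrable setT (EFin \o (f \* g)).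
Proof. by apply/Lfun1_integrable; apply: Lfun2_mul_Lfun1; exact: LfunP. Qed.

Lemma L2_sqr_integrable f : mu.-integrable setT (fun x => (f x ^+ 2)%:E).
Proof. exact: Lfun2_integrable_sqr (LfunP f). Qed.

Lemma EFin_L2dot f : ((L2dot f f)%:E = \int[mu]_x (f x ^+ 2)%:E)%E.
Proof. by rewrite fineK// integrable_fin_num//; exact: L2_sqr_integrable. Qed.

Lemma L2dot_psd : psd_form (@L2dot _ T R mu).
Proof.
split.
- by move=> f g; apply: eq_Rintegral => x _; rewrite mulrC.
- move=> a f g h.
  rewrite -RintegralZl//; last exact: L2_mul_integrable.
  rewrite -RintegralD//.
  + by apply: eq_Rintegral => x _ /=; rewrite mulrDl mulrA.
  + exact: (integrableZl measurableT a (L2_mul_integrable f h)).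
  + exact: L2_mul_integrable.
- by move=> f; apply: Rintegral_ge0 => x _; rewrite -expr2 sqr_ge0.
Qed.

Lemma L2dot_eq0 f : L2dot f f = 0 <-> f = 0 %[ae mu].
Proof.
have mf2 : measurable_fun setT (EFin \o (fun x => f x ^+ 2)).
  by apply/measurable_EFinP; apply: measurable_funX.
have -> : L2dot f f = 0 <-> (\int[mu]_x (f x ^+ 2)%:E = 0)%E.
  by rewrite -EFin_L2dot; split => [->//|[]].
have := ae_eq_integral_abs mu measurableT mf2.
under eq_integral do rewrite gee0_abs ?lee_fin ?sqr_ge0//.
move=> ->; split; apply: filterS => x /=.
  by move=> /(_ I)[] /eqP; rewrite sqrf_eq0 => /eqP.
by move=> /(_ I) -> _; rewrite expr0n.
Qed.

Lemma L2dot_sub_eq0 f g : L2dot (f - g) (f - g) = 0 <-> f = g %[ae mu].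
Proof.
rewrite L2dot_eq0; split; apply: filterS => x /= /(_ I) fg _.
  by apply/eqP; rewrite -subr_eq0; exact/eqP.
by apply/eqP; rewrite subr_eq0; exact/eqP.
Qed.

Lemma L2_of_fun (u : T -> R) : measurable_fun setT u ->
  (\int[mu]_x (u x ^+ 2)%:E < +oo)%E -> exists f : L2 mu, f =1 u.
Proof.
move=> mmu u2; have uL : u \in Lfun mu 2%:E.
  rewrite inE/=; apply/andP; split; rewrite inE//=.
  rewrite /finite_norm unlock poweR_lty//.
  under eq_integral => x _/= do rewrite powR_mulrn// real_normK ?num_real//.
  by [].
by exists (Lfun_Sub (lee1n 2) uL).
Qed.

(** Riesz-Fischer: summable increments give convergence almost everywhere, and Fatou's lemma
    transfers the distance estimates to the limit. *)
Lemma L2dot_complete : form_complete (@L2dot _ T R mu).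
Proof.
move=> f hf.
pose a (k : nat) (x : T) : \bar R := (`|f k.+1 x - f k x|)%:E.
have a_ge0 k x : (0 <= a k x)%E by rewrite lee_fin.
have ma k : measurable_fun setT (a k).
  by apply/measurable_EFinP; apply: measurableT_comp => //; exact: measurable_funB.
have hf' k j : (k <= j)%N ->
    (\int[mu]_x ((f j x - f k x) ^+ 2)%:E <= ((2^-1 ^+ k) ^+ 2)%:E)%E.
  by move=> kj; rewrite -(EFin_L2dot (f j - f k)) lee_fin; exact: hf.
pose m := fine (mu setT).
have mE : mu setT = m%:E by rewrite fineK// fin_num_measure.
have m0 : 0 <= m by rewrite fine_ge0.
(* With [q = 2^-1 ^+ k], the inequality [t <= t ^+ 2 / (2 * q) + q / 2] turns the [L2] estimate into
   an [L1] one, as the measure is finite. *)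
have int_a k : (\int[mu]_x a k x <= ((1 + m) / 2 * 2^-1 ^+ k)%:E)%E.
  pose q : R := 2^-1 ^+ k.
  have q0 : 0 < q by rewrite exprn_gt0// invr_gt0.
  have := hf' k k.+1 (leqnSn k).
  rewrite -/q => hk.
  have ms : measurable_fun setT (EFin \o (fun x => (f k.+1 x - f k x) ^+ 2)).
    by apply/measurable_EFinP; apply: measurable_funX; exact: measurable_funB.
  have le1 : (\int[mu]_x a k x <=
      \int[mu]_x ((q^-1 / 2)%:E * ((f k.+1 x - f k x) ^+ 2)%:E + (q / 2)%:E))%E.
    apply: ge0_le_integral => //.
    - by apply: emeasurable_funD => //; exact: measurable_funeM.
    - move=> x _; rewrite lee_fin -subr_ge0 -[_ ^+ 2]real_normK ?num_real//.
      set t := `|_|.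
      rewrite (_ : _ - t = (t - q) ^+ 2 / (2 * q)); last by field; rewrite gt_eqF.
      by rewrite divr_ge0 ?sqr_ge0//; nra.
  rewrite (le_trans le1)// ge0_integralD//; last 3 first.
  - by move=> x _; rewrite mule_ge0 ?lee_fin ?sqr_ge0// divr_ge0 ?invr_ge0 ?(ltW q0).
  - exact: measurable_funeM.
  - by move=> x _; rewrite lee_fin divr_ge0// ltW.
  rewrite ge0_integralZl_EFin//; last 2 first.
  - by move=> x _; rewrite lee_fin sqr_ge0.
  - by rewrite divr_ge0// invr_ge0 ltW.
  rewrite integral_cst// [X in (_ + _ * X <= _)%E](_ : _ = m%:E)//.
  rewrite (le_trans (leeD (lee_wpmul2l _ hk) (lexx _)))//.
    by rewrite lee_fin divr_ge0// invr_ge0 ltW.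
  rewrite -!EFinM -EFinD lee_fin le_eqVlt; apply/orP; left; apply/eqP.
  by field; rewrite gt_eqF.
have sum_a : (\int[mu]_x (\sum_(0 <= k <oo) a k x) < +oo)%E.
  rewrite integral_nneseries//.
  apply: (@le_lt_trans _ _ ((1 + m) / 2 / (1 - 2^-1))%:E); last by rewrite ltry.
  apply: nneseries_geometric_le => //.
  - by rewrite divr_ge0//; lra.
  - by lra.
  - by move=> n; apply: integral_ge0 => x _; rewrite lee_fin.
have ae_fin : {ae mu, forall x, (\sum_(0 <= k <oo) a k x < +oo)%E}.
  have : mu.-integrable setT (fun x => \sum_(0 <= k <oo) a k x)%E.
    apply/integrableP; split.
      exact: ge0_emeasurable_sum.
    by under eq_integral do rewrite gee0_abs ?nneseries_ge0//.
  move/(integrable_ae measurableT); apply: filterS => x /(_ I).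
  by rewrite ge0_fin_numE// nneseries_ge0.
(* An upper limit is measurable without any exceptional set; where the sequence converges it is the
   limit. *)
pose g x := fine (limn_esup (fun k => (f k x)%:E)).
have mg : measurable_fun setT g.
  apply: measurableT_comp => //; apply: measurable_fun_limn_esup => k.
  exact/measurable_EFinP.
have ae_cvg : {ae mu, forall x, f k x @[k --> \oo] --> g x}.
  apply: filterS ae_fin => x ax.
  have cv : cvgn (fun k => f k x).
    rewrite (_ : (fun k => f k x) =
        (fun k => f 0%N x + series (telescope (fun k => f k x)) k)); last first.
      by apply/funext => k; exact: (eq_sum_telescope (fun k => f k x)).
    apply: is_cvgD; first exact: is_cvg_cst.
    apply: normed_cvg; apply: nondecreasing_is_cvgn.
      by apply: nondecreasing_series => n _ _; exact: normr_ge0.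
    exists (fine (\sum_(0 <= k <oo) a k x)) => _ [n _ <-].
    rewrite -lee_fin fineK ?ge0_fin_numE ?nneseries_ge0// -sumEFin.
    by apply: (@nneseries_lim_ge _ (a^~ x) xpredT 0%N n).
  have /cvg_limn_einf_sup[_ gE] :
      (f k x)%:E @[k --> \oo] --> (limn (fun k => f k x))%:E.
    by apply/fine_cvgP; split; [exact: nearW|exact: cv].
  by rewrite /g gE; exact: cv.
have dist_g k : (\int[mu]_x ((g x - f k x) ^+ 2)%:E <= ((2^-1 ^+ k) ^+ 2)%:E)%E.
  pose u j x := ((f (j + k)%N x - f k x) ^+ 2)%:E.
  have mu_ j : measurable_fun setT (u j).
    by apply/measurable_EFinP; apply: measurable_funX; exact: measurable_funB.
  rewrite (@ae_eq_integral _ _ _ mu setT (fun x => limn_einf (u ^~ x)))//; last 3 first.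
  - by apply/measurable_EFinP; apply: measurable_funX; exact: measurable_funB.
  - apply: measurableT_comp => //.
    apply: (@measurable_fun_limn_esup _ _ _ _ (fun j x => - u j x)%E) => j.
    exact: measurableT_comp.
  - apply: filterS ae_cvg => x gx _.
    have /cvg_limn_einf_sup[-> //] :
        u j x @[j --> \oo] --> ((g x - f k x) ^+ 2)%:E.
    apply/fine_cvgP; split; first exact: nearW.
    apply: (cvg_comp (fun j => f (j + k)%N x - f k x) (fun y => y ^+ 2)).
      apply: cvgB; last exact: cvg_cst.
      by apply: (cvg_comp (addn^~ k) (fun j => f j x)) gx; exact: cvg_addnr.
    exact: exprn_continuous.
  rewrite (le_trans (fatou mu measurableT mu_ _))//.
    by move=> n x _; rewrite lee_fin sqr_ge0.
  by apply: limn_einf_le => n; apply: hf'; rewrite leq_addl.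
(* Square integrability is known for [g - f 0] only, by the estimate at [k = 0]; adding [f 0] back
   gives the limit as an element of [L2]. *)
have [G0 G0E] : exists G0 : L2 mu, G0 =1 (fun x => g x - f 0%N x).
  apply: L2_of_fun; first exact: measurable_funB.
  by rewrite (le_lt_trans (dist_g 0%N))// ltry.
exists (G0 + f 0%N) => k; rewrite -lee_fin EFin_L2dot.
apply: le_trans (dist_g k); rewrite le_eqVlt; apply/orP; left; apply/eqP.
apply: eq_integral => x _.
have -> : (G0 + f 0%N - f k) x = G0 x + f 0%N x - f k x by [].
by rewrite G0E subrK.
Qed.

End L2Space.

(** * Metric measure spaces and Voronoi cells *)

Lemma measurable_fun_ltP d (T : measurableType d) (R : realType) (f : T -> R) :
  (forall r, measurable [set x | f x < r]) -> measurable_fun setT f.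
Proof.
move=> h; apply: (measurability _ (RGenInftyO.measurableE R)) => //.
move=> _ [_ [r ->] <-]; rewrite setTI.
rewrite (_ : _ @^-1` _ = [set x | f x < r]); first exact: h.
by apply/seteqP; split => x /=; rewrite in_itv.
Qed.

Lemma exists_half_exp_lt (R : realType) (e : R) :
  0 < e -> exists n, 2^-1 ^+ n < e.
Proof.
move=> e0; have [n _ /(_ n (leqnn n))] := near_infty_natSinv_expn_lt (PosNum e0).
by rewrite div1r -exprVn; exists n.
Qed.

Section MetricMeasurability.
Context (R : realType) (X : pmetricType R).

Lemma open_borel_measurable (A : set X) : open A -> measurable (A : set (borel X)).
Proof. by move=> oA; exact: sub_sigma_algebra. Qed.

Lemma mdist_ball_open (x : X) r : open [set y | mdist x y < r].
Proof.
rewrite openE => y /= xy; apply/nbhs_ballP; exists (r - mdist x y) => /=.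
  by rewrite subr_gt0.
move=> z; rewrite ballEmdist /= => yz; have := metric_triangle x y z; lra.
Qed.

Lemma measurable_mdist (x : X) :
  measurable_fun setT (fun y : borel X => mdist x (y : X)).
Proof.
apply: measurable_fun_ltP => r; apply: open_borel_measurable.
exact: mdist_ball_open.
Qed.

Lemma compact_mdist_bounded : compact [set: X] ->
  exists M : R, forall x y : X, mdist x y <= M.
Proof.
rewrite compact_cover => /(_ nat setT (fun n => [set y : X | mdist point y < n%:R])).
case=> [n _|x _|F _ cvF]; first exact: mdist_ball_open.
  exists (Num.bound (mdist point x)) => //=.
  by apply: archi_boundP; exact: mdist_ge0.
pose M : R := \sum_(n <- F) n%:R.
have ptM (x : X) : mdist point x <= M.
  have [n nF /= xn] := cvF x I; rewrite (le_trans (ltW xn))//.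
  by rewrite /M (big_rem n)//= lerDl sumr_ge0.
exists (M + M) => x y; rewrite (le_trans (metric_triangle x point y))//.
by rewrite lerD// metric_sym.
Qed.

Lemma mdist_le_diam : compact [set: X] -> forall x y : X, mdist x y <= diam X.
Proof.
move=> /compact_mdist_bounded[M hM] x y.
apply: sup_upper_bound; last by exists x, y.
by split; [exists (mdist x y), x, y | exists M => _ [a [b ->]]].
Qed.

(** The product carries the product of the Borel sigma-algebras, so each sublevel set has to be
    built from functions of one variable: the distance is below [r] when some point [p] of the
    countably many net points satisfies [mdist p z.1 + mdist p z.2 < r]. *)
Lemma measurable_mdist_prod :
  (forall e : R, 0 < e -> exists s : seq X, forall x, exists2 y, y \in s & mdist x y < e) ->
  measurable_fun setT (fun z : borel X * borel X => mdist (z.1 : X) (z.2 : X)).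
Proof.
move=> net.
have e0 n : 0 < 2^-1 ^+ n :> R by rewrite exprn_gt0// invr_gt0.
have /choice[s hs] := fun n => net _ (e0 n).
apply: measurable_fun_ltP => r.
rewrite (_ : [set z | _] = \bigcup_n \big[setU/set0]_(p <- s n)
    [set z : borel X * borel X | mdist p (z.1 : X) + mdist p (z.2 : X) < r]).
  apply: bigcup_measurable => n _; apply: bigsetU_measurable => p _.
  rewrite (_ : [set z | _] = setT `&` (fun z : borel X * borel X =>
      mdist p (z.1 : X) + mdist p (z.2 : X) < r) @^-1` [set true]); last first.
    by rewrite setTI.
  apply: measurable_fun_ltr => //; apply: measurable_funD.
    exact: measurableT_comp (measurable_mdist p) _.
  exact: measurableT_comp (measurable_mdist p) _.
apply/seteqP; split => [z /= zr|z [n _]]; last first.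
  rewrite -bigcup_seq => -[p _ /=]; apply: le_lt_trans.
  by rewrite (metric_sym p z.1) metric_triangle.
(* Passing through [p] costs at most twice the distance from [p] to [z.1], hence half of the gap. *)
pose e := (r - mdist (z.1 : X) (z.2 : X)) / 2.
have ep : 0 < e by rewrite divr_gt0// subr_gt0.
have [n ne] := exists_half_exp_lt ep.
exists n => //; rewrite -bigcup_seq.
have [p ps pz] := hs n (z.1 : X); exists p => //=.
have := metric_triangle p (z.1 : X) (z.2 : X).
rewrite (metric_sym p z.1) /e in ne *; lra.
Qed.

End MetricMeasurability.

Definition cball (R : realType) (X : pmetricType R) (x : X) (r : R) : set (borel X) :=
  [set y : X | mdist x y <= r].

Lemma cball_measurable (R : realType) (X : pmetricType R) (x : X) (r : R) :
  measurable (cball x r).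
Proof.
rewrite (_ : cball x r = setT `&` (fun y : borel X => mdist x (y : X) <= r) @^-1` [set true]).
  by apply: measurable_fun_ler => //; exact: measurable_mdist.
by rewrite setTI.
Qed.

(* Ahlfors regularity with explicit constants, the upper bound being extended
   to all radii. *)
Record ahlfors (R : realType) (X : pmetricType R)
    (mu : {finite_measure set (borel X) -> \bar R}) (df c C D : R) : Prop :=
  Ahlfors {
    ahl_df : 0 < df ; ahl_c : 0 < c ; ahl_C : 0 < C ; ahl_D : 0 < D ;
    ahl_bounded : forall x y : X, mdist x y <= D ;
    ahl_lower : forall (x : X) r, 0 <= r -> r < D ->
      ((c * r `^ df)%:E <= mu (cball x r))%E ;
    ahl_upper : forall (x : X) r, 0 <= r ->
      (mu (cball x r) <= (C * r `^ df)%:E)%E }.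

Lemma regular_ahlfors (R : realType) (X : pmetricType R)
    (mu : {finite_measure set (borel X) -> \bar R}) (df : R) :
  compact [set: X] -> 0 < df -> ahlfors_regular mu df -> 0 < diam X ->
  exists c C, ahlfors mu df c C (diam X).
Proof.
move=> cptX df0 [C C1 reg] D0.
have bdd := mdist_le_diam cptX.
have C0 : 0 < C by lra.
pose m := fine (mu setT).
have mE : mu setT = m%:E by rewrite fineK// fin_num_measure.
have m0 : 0 <= m by rewrite fine_ge0.
(* The second term serves radii beyond the diameter, where the total mass bounds every ball. *)
pose C' := Num.max C (m / diam X `^ df).
have C'0 : 0 < C' by rewrite lt_max C0.
exists C^-1, C'; split => //; first by rewrite invr_gt0.
  by move=> x r r0 rD; have [] := reg x r r0 rD.
move=> x r r0; have [rD|Dr] := ltP r (diam X).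
  have [_ h] := reg x r r0 rD; apply: (le_trans h).
  by rewrite lee_fin ler_wpM2r ?powR_ge0// le_max lexx.
apply: (@le_trans _ _ (mu setT)).
  by apply: le_measure; rewrite ?inE//; exact: cball_measurable.
rewrite [leLHS]mE lee_fin (@le_trans _ _ (m / diam X `^ df * r `^ df))//.
  rewrite -mulrA ler_peMr// mulrC ler_pdivlMr ?powR_gt0// mul1r.
  by rewrite ge0_ler_powR ?nnegrE// ltW.
by rewrite ler_wpM2r ?powR_ge0// le_max lexx orbT.
Qed.

Section Nets.
Context (R : realType) (X : pmetricType R).
Variable mu : {finite_measure set (borel X) -> \bar R}.
Variables df c C D : R.
Hypothesis ahl : ahlfors mu df c C D.

Let m := fine (mu setT).

Let muT : mu setT = m%:E.
Proof. by rewrite fineK// fin_num_measure. Qed.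

Definition mdist_separated (r : R) (s : seq X) := pairwise (fun x y => r <= mdist x y) s.

Lemma mdist_separated_nth r s (x0 : X) i j : mdist_separated r s ->
  (i < size s)%N -> (j < size s)%N -> i != j ->
  r <= mdist (nth x0 s i) (nth x0 s j).
Proof.
move=> /(pairwiseP x0) sep si sj; rewrite neq_ltn => /orP[]; first exact: sep.
by rewrite metric_sym; exact: sep.
Qed.

Lemma mdist_separated_disjoint r s (x0 : X) (e : R) : mdist_separated r s -> 2 * e < r ->
  trivIset setT (fun i : 'I_(size s) => cball (nth x0 s i) e).
Proof.
move=> sep er; apply/trivIsetP => i j _ _ ij; apply/seteqP; split => // z [].
rewrite /cball /= (metric_sym (nth x0 s j)) => zi zj.
have := metric_triangle (nth x0 s i) z (nth x0 s j).
have := mdist_separated_nth x0 sep (ltn_ord i) (ltn_ord j) ij.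
by lra.
Qed.

(** Packing by volume. The radius is [r / 3] and not [r / 2] because closed balls of radius [r / 2]
    may touch. *)
Lemma mdist_separated_size r s : 0 < r -> r < D -> mdist_separated r s ->
  (size s)%:R * (c * (r / 3) `^ df) <= m.
Proof.
move=> r0 rD sep; pose x0 : X := point.
have mB (i : 'I_(size s)) : measurable (cball (nth x0 s i) (r / 3)).
  exact: cball_measurable.
have tB : trivIset setT (fun i : 'I_(size s) => cball (nth x0 s i) (r / 3)).
  by apply: mdist_separated_disjoint sep _; lra.
rewrite -lee_fin.
apply: (@le_trans _ _ (mu (\big[setU/set0]_(i < size s) cball (nth x0 s i) (r / 3)))).
  rewrite (measure_bigsetU_ord mu xpredT mB tB).
  rewrite mulr_natl -[size s in leLHS]card_ord -sumr_const -sumEFin.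
  by apply: lee_sum => i _; apply: (ahl_lower ahl); lra.
rewrite -[leRHS]muT; apply: le_measure; rewrite ?inE//.
exact: bigsetU_measurable.
Qed.

(** A separated family of maximal size, which exists by the packing bound, is also a covering net:
    an uncovered point could be added. *)
Lemma exists_net r : 0 < r -> r < D ->
  exists2 s : seq X, mdist_separated r s & forall x, exists2 y, y \in s & mdist x y < r.
Proof.
move=> r0 rD; pose P n := `[< exists2 s, size s = n & mdist_separated r s >].
have P0 : exists n, P n by exists 0%N; apply/asboolP; exists [::].
pose w := c * (r / 3) `^ df.
have w0 : 0 < w by rewrite mulr_gt0 ?(ahl_c ahl) ?powR_gt0 ?divr_gt0.
have Pub n : P n -> (n <= Num.bound (m / w))%N.
  move=> /asboolP[s <- /(mdist_separated_size r0 rD)]; rewrite -/w -ler_pdivlMr// => h.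
  rewrite -(ler_nat R) (le_trans h)// ltW//.
  by apply: archi_boundP; rewrite divr_ge0 ?(ltW w0)// fine_ge0.
have [n /asboolP[s sn sep] nmax] := ex_maxnP P0 Pub.
exists s => // x; apply: contrapT => xs.
have : P n.+1.
  apply/asboolP; exists (x :: s); first by rewrite /= sn.
  rewrite /mdist_separated /= -/(mdist_separated r s) sep andbT; apply/allP => y ys.
  by rewrite leNgt; apply/negP => xy; apply: xs; exists y.
by move=> /nmax; rewrite ltnn.
Qed.

Lemma mdist_measurable :
  measurable_fun setT (fun z : borel X * borel X => mdist (z.1 : X) (z.2 : X)).
Proof.
apply: measurable_mdist_prod => e e0.
have D0 := ahl_D ahl.
have [||s _ hs] := @exists_net (Num.min e (D / 2)).
- by rewrite lt_min e0; lra.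
- by rewrite gt_min; apply/orP; right; lra.
- exists s => x; have [y ys xy] := hs x; exists y => //.
  by apply: (lt_le_trans xy); rewrite ge_min lexx.
Qed.

Section Cells.
Variables (k : nat) (p : 'I_k -> X) (r : R).
Hypothesis r_gt0 : 0 < r.
Hypothesis p_sep : forall i j : 'I_k, i != j -> r <= mdist (p i) (p j).
Hypothesis p_cover : forall x, exists i, mdist x (p i) < r.

(** Ties go to the smallest index, so that the cells form an exact partition and not one up to
    boundaries of unknown measure. *)
Definition voronoi (i : 'I_k) : set (borel X) := [set x : X |
  forall j : 'I_k, if (j < i)%N then mdist (p i) x < mdist (p j) x
            else mdist (p i) x <= mdist (p j) x].

Lemma voronoi_measurable i : measurable (voronoi i).
Proof.
rewrite (_ : voronoi i = \big[setI/setT]_(j < k) (setT `&`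
   (fun x : borel X => if (j < i)%N then mdist (p i) (x : X) < mdist (p j) (x : X)
            else mdist (p i) (x : X) <= mdist (p j) (x : X)) @^-1` [set true])).
  apply: bigsetI_measurable => j _; case: (j < i)%N.
    by apply: measurable_fun_ltr => //; exact: measurable_mdist.
  by apply: measurable_fun_ler => //; exact: measurable_mdist.
rewrite -bigcap_seq; apply/seteqP; split => x /= h.
  by move=> j _; split => //=; have := h j; case: ifP.
by move=> j; have [//|_ /=] := h j; first exact: mem_index_enum; case: ifP.
Qed.

Lemma voronoi_disjoint : trivIset setT voronoi.
Proof.
apply/trivIsetP => i j _ _ ij; apply/seteqP; split => // x [/(_ j) xi /(_ i) xj].
move: xi xj; move: ij; rewrite neq_ltn => /orP[] ij; rewrite ij ltnNge (ltnW ij) /=; lra.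
Qed.

Lemma voronoi_cover : \big[setU/set0]_(i < k) voronoi i = setT.
Proof.
apply/seteqP; split => // x _; rewrite -bigcup_seq.
have [i0 _] := p_cover x.
(* A nearest center is chosen, then the smallest index among the nearest ones. *)
case: (@arg_minP _ _ _ i0 xpredT (fun i => mdist (p i) x)) => // i1 _ min1.
case: (@arg_minnP _ i1 (fun i => mdist (p i) x == mdist (p i1) x) (fun i => i)) => //.
move=> i2 /eqP e2 min2; exists i2 => [|j] /=; first exact: mem_index_enum.
case: ifPn => ji; last by rewrite e2 min1.
rewrite e2 lt_neqAle min1// andbT eq_sym; apply/negP => /min2.
by rewrite leqNgt ji.
Qed.

Lemma voronoi_sub i : voronoi i `<=` cball (p i) r.
Proof.
move=> x /= xi; have [j xj] := p_cover x.
have := xi j; rewrite /cball /= (metric_sym (p j)); case: ifP => _; lra.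
Qed.

(** A point within [r / 3] of [p i] is at distance at least [2 * r / 3] from every other center.
    This gives the lower bound on the measure of cells. *)
Lemma sub_voronoi i : cball (p i) (r / 3) `<=` voronoi i.
Proof.
move=> x; rewrite /cball /= => xi j.
have [->|ij] := eqVneq j i; first by rewrite ltnn lexx.
have ri := p_sep ij; have := metric_triangle (p j) x (p i).
rewrite (metric_sym x); case: ifP => _; have := r_gt0; lra.
Qed.

End Cells.

End Nets.

(** * The Poincare inequality *)

Lemma EFin_Rintegral d (T : measurableType d) (R : realType)
    (mu : {measure set T -> \bar R}) (D : set T) (g : T -> R) :
  measurable D -> mu.-integrable D (EFin \o g) ->
  (\int[mu]_(x in D) (g x)%:E = (\int[mu]_(x in D) g x)%R%:E)%E.
Proof. by move=> mD ig; rewrite fineK// integrable_fin_num. Qed.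

Section Indicator.
Context d (T : measurableType d) (R : realType).
Variable mu : {finite_measure set T -> \bar R}.

Lemma L2_integrable (D : set T) (f : L2 mu) : measurable D ->
  mu.-integrable D (EFin \o f).
Proof.
move=> mD; apply: (@integrableS _ _ _ _ setT) => //.
have := L2_mul_integrable f (Lfun_Sub (lee1n 2) (Lfun_cst mu 1 2)).
by apply: eq_integrable => // x _ /=; rewrite mulr1.
Qed.

Lemma L2_indic (D : set T) : measurable D -> exists w : L2 mu, w =1 (\1_D : T -> R).
Proof.
move=> mD; apply: L2_of_fun; first exact: measurable_indic.
under eq_integral => x _ do rewrite indicE expr2 -natrM mulnb andbb -indicE.
by rewrite integral_indic// setIT ltey_eq fin_num_measure.
Qed.

Lemma L2dot_indic (D : set T) (w f : L2 mu) : measurable D ->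
  w =1 (\1_D : T -> R) -> L2dot f w = \int[mu]_(x in D) f x.
Proof.
move=> mD wD; rewrite Rintegral_mkcond; apply: eq_Rintegral => x _.
by rewrite wD indicE patchE; case: (x \in D); rewrite (mulr1, mulr0).
Qed.

End Indicator.

Section Energy.
Context (R : realType) (X : pmetricType R).
Variable mu : {finite_measure set (borel X) -> \bar R}.

Definition gagliardo (s : R) (f : borel X -> R) (x y : borel X) : R :=
  (f x - f y) ^+ 2 / mdist (x : X) (y : X) `^ s.

Lemma gagliardo_ge0 s f x y : 0 <= gagliardo s f x y.
Proof. by rewrite divr_ge0 ?sqr_ge0 ?powR_ge0. Qed.

(** Without the factor [2^-1] of [Ealpha], and with values in the extended reals so that it makes
    sense for every measurable function. *)
Definition energy (s : R) (f : borel X -> R) : \bar R :=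
  (\int[mu]_x \int[mu]_y (gagliardo s f x y)%:E)%E.

Hypothesis mdist_meas :
  measurable_fun setT (fun z : borel X * borel X => mdist (z.1 : X) (z.2 : X)).

Lemma measurable_gagliardo s (f : borel X -> R) : measurable_fun setT f ->
  measurable_fun setT (fun z : borel X * borel X => (gagliardo s f z.1 z.2)%:E).
Proof.
move=> mf; apply/measurable_EFinP; apply: measurable_funM.
  apply: measurable_funX; apply: measurable_funB.
    exact: measurableT_comp mf _.
  exact: measurableT_comp mf _.
rewrite (_ : (fun z => _) = (fun z : borel X * borel X =>
    mdist (z.1 : X) (z.2 : X) `^ (- s))); last first.
  by apply/funext => z; rewrite powRN.
exact: (measurableT_comp (@measurable_powR R (- s)) mdist_meas).
Qed.

Lemma measurable_gagliardo_section s (f : borel X -> R) x : measurable_fun setT f ->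
  measurable_fun setT (fun y => (gagliardo s f x y)%:E).
Proof.
move=> /(measurable_gagliardo s) mq.
exact: (measurableT_comp mq (pair1_measurable x)).
Qed.

Lemma measurable_energy_density s (f : borel X -> R) : measurable_fun setT f ->
  measurable_fun setT (fun x => \int[mu]_y (gagliardo s f x y)%:E)%E.
Proof.
move=> /(measurable_gagliardo s) mq.
apply: (measurable_fun_fubini_tonelli_F (m2 := mu) _ mq) => z.
by rewrite lee_fin gagliardo_ge0.
Qed.

(** On the cell the kernel is at least [delta ^ (-s)], and [2 * v] is the double integral of
    [(f x - f y) ^+ 2] over the cell. On the right [y] ranges over the whole space, so that summing
    over the cells of a partition yields the full energy. *)
Lemma cell_energy (s delta : R) (D : set (borel X)) (f : L2 mu) :
  measurable D -> 0 < s -> 0 < delta ->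
  (forall x y, D x -> D y -> mdist (x : X) (y : X) <= delta) ->
  let v := fine (mu D) * \int[mu]_(x in D) (f x ^+ 2) -
    (\int[mu]_(x in D) f x) ^+ 2 in
  0 <= v /\ ((2 * delta `^ (- s) * v)%:E <=
    \int[mu]_(x in D) \int[mu]_y (gagliardo s f x y)%:E)%E.
Proof.
move=> mD s0 d0 diamD /=; set a := \int[mu]_(x in D) f x.
set b := \int[mu]_(x in D) (f x ^+ 2); set m := fine (mu D).
have mE : mu D = m%:E by rewrite fineK// fin_num_measure.
have mf : measurable_fun setT f := measurable_L2 f.
have if1 : mu.-integrable D (EFin \o f) by exact: L2_integrable.
have if2 : mu.-integrable D (EFin \o (fun x => f x ^+ 2)).
  by apply: (@integrableS _ _ _ _ setT) => //; exact: L2_sqr_integrable.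
have icst (r : R) : mu.-integrable D (EFin \o cst r).
  exact: finite_measure_integrable_cst.
(* For fixed [x] the squared difference is a quadratic polynomial in [f y], and its integral is
   again one in [f x]; both integrations use this formula. *)
have int_quad (u v w : R) : mu.-integrable D (EFin \o (fun x => u * f x ^+ 2 + v * f x + w)) /\
    \int[mu]_(x in D) (u * f x ^+ 2 + v * f x + w) = u * b + v * a + w * m.
  have i2 : mu.-integrable D (EFin \o (fun x => u * f x ^+ 2)).
    exact: (integrableZl mD u if2).
  have i1 : mu.-integrable D (EFin \o (fun x => v * f x)).
    exact: (integrableZl mD v if1).
  have i21 : mu.-integrable D (EFin \o (fun x => u * f x ^+ 2 + v * f x)).
    exact: (integrableD mD i2 i1).
  split; first exact: (integrableD mD i21 (icst w)).
  rewrite (RintegralD mD i21 (icst w)) (RintegralD mD i2 i1).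
  by rewrite !RintegralZl// Rintegral_cst.
pose e := delta `^ (- s).
have e0 : 0 <= e by rewrite powR_ge0.
have inner_quad x : e * m * f x ^+ 2 + (- 2 * e * a) * f x + e * b =
    \int[mu]_(y in D) (e * f y ^+ 2 + (- 2 * e * f x) * f y + e * f x ^+ 2).
  by rewrite (int_quad _ _ _).2; ring.
have inner x : D x ->
    ((e * m * f x ^+ 2 + (- 2 * e * a) * f x + e * b)%:E <=
      \int[mu]_y (gagliardo s f x y)%:E)%E.
  move=> Dx; apply: (@le_trans _ _ (\int[mu]_(y in D) (gagliardo s f x y)%:E)%E); last first.
    apply: ge0_subset_integral => //; first exact: measurable_gagliardo_section.
    by move=> y _; rewrite lee_fin gagliardo_ge0.
  have [iq _] := int_quad e (- 2 * e * f x) (e * f x ^+ 2).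
  rewrite inner_quad -EFin_Rintegral//.
  apply: ge0_le_integral => //.
  - move=> y _; rewrite lee_fin.
    rewrite (_ : _ + _ = e * (f x - f y) ^+ 2); last by ring.
    by rewrite mulr_ge0// sqr_ge0.
  - by case/integrableP: iq.
  - apply: measurable_funTS; exact: measurable_gagliardo_section.
  - move=> y Dy; rewrite lee_fin.
    rewrite (_ : _ + _ = (f x - f y) ^+ 2 * e); last by ring.
    (* On the diagonal both sides vanish; off it the kernel is compared. *)
    have [xy|xy] := eqVneq (x : X) (y : X); first by rewrite /gagliardo xy subrr expr0n !mul0r.
    rewrite ler_wpM2l ?sqr_ge0// /e powRN lef_pV2 ?posrE ?powR_gt0 ?mdist_gt0//.
    by rewrite ge0_ler_powR ?nnegrE ?mdist_ge0 ?(ltW s0) ?(ltW d0)//; exact: diamD.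
have [iq qE] := int_quad (e * m) (- 2 * e * a) (e * b).
have vE : 2 * e * (m * b - a ^+ 2) =
    \int[mu]_(x in D) (e * m * f x ^+ 2 + (- 2 * e * a) * f x + e * b).
  by rewrite qE; ring.
have quad_ge0 x : 0 <= e * m * f x ^+ 2 + (- 2 * e * a) * f x + e * b.
  rewrite inner_quad; apply: Rintegral_ge0 => y _.
  rewrite (_ : _ + _ = e * (f x - f y) ^+ 2); last by ring.
  by rewrite mulr_ge0// sqr_ge0.
split.
  have : 0 < 2 * e by rewrite mulr_gt0// powR_gt0.
  by move=> /pmulr_rge0 <-; rewrite vE; apply: Rintegral_ge0.
rewrite vE -EFin_Rintegral//.
apply: ge0_le_integral => //.
- by move=> x _; rewrite lee_fin.
- by case/integrableP: iq.
- apply: measurable_funTS; exact: measurable_energy_density.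
Qed.

Lemma poincare_partition (s delta m0 : R) (k : nat) (F : 'I_k -> set (borel X))
    (f : L2 mu) :
  0 < s -> 0 < delta -> 0 < m0 ->
  (forall i, measurable (F i)) -> trivIset setT F ->
  \big[setU/set0]_(i < k) F i = setT ->
  (forall i x y, F i x -> F i y -> mdist (x : X) (y : X) <= delta) ->
  (forall i, m0 <= fine (mu (F i))) ->
  (energy s f < +oo)%E ->
  L2dot f f <= delta `^ s / (2 * m0) * fine (energy s f) +
    \sum_(i < k) (\int[mu]_(x in F i) f x) ^+ 2 / fine (mu (F i)).
Proof.
move=> s0 d0 m00 mF tF cF dF m0F fin.
have uI := index_enum_uniq 'I_k.
have tF' : trivIset [set` index_enum 'I_k] F by apply: sub_trivIset tF.
pose b i := \int[mu]_(x in F i) (f x ^+ 2).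
pose a i := \int[mu]_(x in F i) f x.
pose m i := fine (mu (F i)).
have cell i := cell_energy f (mF i) s0 d0 (dF i).
have energy_ge : \sum_i (2 * delta `^ (- s) * (m i * b i - a i ^+ 2)) <=
    fine (energy s f).
  rewrite -lee_fin fineK; last first.
    rewrite ge0_fin_numE//; apply: integral_ge0 => x _; apply: integral_ge0 => y _.
    by rewrite lee_fin gagliardo_ge0.
  have -> : (energy s f =
      \sum_i \int[mu]_(x in F i) \int[mu]_y (gagliardo s f x y)%:E)%E.
    rewrite -(ge0_integral_bigsetU mu mF uI tF') ?cF//.
      exact: measurable_energy_density.
    by move=> x _; apply: integral_ge0 => y _; rewrite lee_fin gagliardo_ge0.
  by rewrite -sumEFin; apply: lee_sum => i _; exact: (cell i).2.
have L2E : L2dot f f = \sum_i b i.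
  apply: EFin_inj; rewrite EFin_L2dot.
  have -> : (\int[mu]_x (f x ^+ 2)%:E = \sum_i \int[mu]_(x in F i) (f x ^+ 2)%:E)%E.
    rewrite -(ge0_integral_bigsetU mu mF uI tF') ?cF//.
      by apply/measurable_EFinP; apply: measurable_funX; exact: measurable_L2.
    by move=> x _; rewrite lee_fin sqr_ge0.
  rewrite -sumEFin; apply: eq_bigr => i _; rewrite EFin_Rintegral//.
  by apply: (@integrableS _ _ _ _ setT) => //; exact: L2_sqr_integrable.
rewrite L2E (@le_trans _ _ (delta `^ s / (2 * m0) *
    (\sum_i (2 * delta `^ (- s) * (m i * b i - a i ^+ 2))) +
    \sum_(i < k) a i ^+ 2 / m i))//; last first.
  by rewrite lerD2r ler_wpM2l// divr_ge0 ?powR_ge0// mulr_ge0// ltW.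
rewrite mulr_sumr -big_split/=; apply: ler_sum => i _.
have [v0 _] := cell i; rewrite -/(m i) -/(a i) -/(b i) in v0.
have m_gt0 : 0 < m i by rewrite (lt_le_trans m00)//; exact: m0F.
have -> : delta `^ s / (2 * m0) * (2 * delta `^ (- s) * (m i * b i - a i ^+ 2)) =
    (m i * b i - a i ^+ 2) / m0.
  rewrite powRN; field; rewrite gt_eqF//= gt_eqF//; exact: powR_gt0.
rewrite -lerBlDr (_ : b i - _ = (m i * b i - a i ^+ 2) / m i); last first.
  by field; rewrite gt_eqF.
by rewrite ler_wpM2l// lef_pV2 ?posrE//; exact: m0F.
Qed.

End Energy.

Lemma powR_div (R : realType) (x y p : R) : 0 <= x -> 0 < y ->
  (x / y) `^ p = x `^ p / y `^ p.
Proof.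
move=> x0 y0; have yp : y `^ p != 0 by rewrite gt_eqF// powR_gt0.
apply: (mulIf yp); rewrite divfK// -powRM ?divr_ge0 ?(ltW y0)//.
by rewrite divfK// gt_eqF.
Qed.

Section TestFunctions.
Context (R : realType) (X : pmetricType R).
Variable mu : {finite_measure set (borel X) -> \bar R}.
Variables df c C D : R.
Hypothesis ahl : ahlfors mu df c C D.

(** The cell terms are squared inner products with the indicators divided by the square root of
    their measure. *)
Lemma partition_test_functions (s delta m0 : R) (k : nat) (F : 'I_k -> set (borel X)) :
  0 < s -> 0 < delta -> 0 < m0 ->
  (forall i, measurable (F i)) -> trivIset setT F ->
  \big[setU/set0]_(i < k) F i = setT ->
  (forall i x y, F i x -> F i y -> mdist (x : X) (y : X) <= delta) ->
  (forall i, m0 <= fine (mu (F i))) ->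
  exists w : 'I_k -> L2 mu, forall f : L2 mu, (energy mu s f < +oo)%E ->
    L2dot f f <= delta `^ s / (2 * m0) * fine (energy mu s f) +
      \sum_i L2dot f (w i) ^+ 2.
Proof.
move=> s0 d0 m00 mF tF cF dF m0F.
have m_gt0 i : 0 < fine (mu (F i)) := lt_le_trans m00 (m0F i).
have /choice[w0 hw0] := fun i => L2_indic mu (mF i).
exists (fun i => (Num.sqrt (fine (mu (F i))))^-1 *: w0 i) => f fin.
have := poincare_partition (mdist_measurable ahl) s0 d0 m00 mF tF cF dF m0F fin.
suff -> : \sum_(i < k) L2dot f ((Num.sqrt (fine (mu (F i))))^-1 *: w0 i) ^+ 2 =
  \sum_(i < k) (\int[mu]_(x in F i) f x) ^+ 2 / fine (mu (F i)) by [].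
apply: eq_bigr => i _.
rewrite (dotZr (L2dot_psd mu)) (L2dot_indic _ (mF i) (hw0 i)) exprMn exprVn.
by rewrite sqr_sqrtr 1?mulrC// ltW.
Qed.

Lemma total_mass_gt0 : 0 < fine (mu setT).
Proof.
have D0 := ahl_D ahl; have D2 : 0 <= D / 2 by lra.
have D2D : D / 2 < D by lra.
apply: (@lt_le_trans _ _ (c * (D / 2) `^ df)).
  by rewrite mulr_gt0 ?(ahl_c ahl) ?powR_gt0//; lra.
rewrite -lee_fin fineK ?fin_num_measure//.
apply: (le_trans (ahl_lower ahl point D2 D2D)).
by apply: le_measure; rewrite ?inE//; exact: cball_measurable.
Qed.

(** For [r < D] the cells are those of an [r]-net; for larger [r] the whole space is a single cell,
    whence the maximum with 1. *)
Lemma poincare_net (a : R) : 0 < a -> exists2 A, 0 < A & forall r, 0 < r ->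
  exists k (w : 'I_k -> L2 mu), k%:R <= Num.max 1 (A * r `^ (- df)) /\
    forall f : L2 mu, (energy mu (df + 2 * a) f < +oo)%E ->
      L2dot f f <= A * r `^ (2 * a) * (2^-1 * fine (energy mu (df + 2 * a) f)) +
        \sum_i L2dot f (w i) ^+ 2.
Proof.
move=> a0; have df0 := ahl_df ahl; have c0 := ahl_c ahl; have D0 := ahl_D ahl.
have mass0 := total_mass_gt0; set m := fine (mu setT) in mass0.
pose s := df + 2 * a; have s0 : 0 < s by rewrite addr_gt0// mulr_gt0.
(* [A1] comes from cells of diameter [2 * r] and mass at least [c * (r / 3) ^ df], [A2] from the
   single cell of diameter [D], and [A3] from the number of net points. *)
pose A1 := 2 `^ s * 3 `^ df / c; pose A2 := D `^ df / m; pose A3 := m * 3 `^ df / c.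
have A10 : 0 < A1 by rewrite divr_gt0// mulr_gt0// powR_gt0.
pose A := Num.max A1 (Num.max A2 A3).
have A0 : 0 < A by rewrite lt_max A10.
have A1A : A1 <= A by rewrite le_max lexx.
have A2A : A2 <= A by rewrite !le_max lexx orbT.
have A3A : A3 <= A by rewrite !le_max lexx !orbT.
exists A => // r r0.
have r3 : (r / 3) `^ df = r `^ df / 3 `^ df by exact: powR_div (ltW r0) _.
have energy_ge0 (f : L2 mu) : 0 <= fine (energy mu s f).
  apply: fine_ge0; apply: integral_ge0 => x _; apply: integral_ge0 => y _.
  by rewrite lee_fin gagliardo_ge0.
have [rD|Dr] := ltP r D; last first.
  have [||||w hw] := @partition_test_functions s D m 1 (fun=> setT) s0 D0 mass0 (fun=> measurableT).
  - by apply/trivIsetP => i j _ _; rewrite !ord1.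
  - by rewrite big_ord1.
  - by move=> _ x y _ _; exact: ahl_bounded ahl _ _.
  - by move=> _; exact: lexx.
  exists 1%N, w; split; first by rewrite le_max lexx.
  move=> f fin; apply: (le_trans (hw f fin)); rewrite lerD2r.
  rewrite mulrA ler_wpM2r//.
  have -> : D `^ s / (2 * m) = A2 * D `^ (2 * a) / 2.
    rewrite /s powRD ?(gt_eqF D0) ?implybT// /A2; field; exact: lt0r_neq0.
  rewrite ler_pM2r ?invr_gt0//.
  apply: ler_pM => //; rewrite ?powR_ge0//.
    by rewrite divr_ge0 ?powR_ge0// ltW.
  by rewrite ge0_ler_powR ?nnegrE ?mulr_ge0// ltW.
have [sq sep cov] := exists_net ahl r0 rD.
pose x0 : X := point.
pose p (i : 'I_(size sq)) := nth x0 sq i.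
have p_sep (i j : 'I_(size sq)) : i != j -> r <= mdist (p i) (p j).
  by move=> ij; apply: mdist_separated_nth sep _ _ _.
have p_cov x : exists i, mdist x (p i) < r.
  have [y ys xy] := cov x.
  have yi : (index y sq < size sq)%N by rewrite index_mem.
  by exists (Ordinal yi); rewrite /p /= nth_index.
have m00 : 0 < c * (r / 3) `^ df by rewrite mulr_gt0 ?powR_gt0 ?divr_gt0.
have r2 : 0 < 2 * r by rewrite mulr_gt0.
have [||w hw] := @partition_test_functions s (2 * r) (c * (r / 3) `^ df) _ (voronoi p)
    s0 r2 m00 (voronoi_measurable p) (voronoi_disjoint (p := p)) (voronoi_cover p_cov).
- move=> i x y /(voronoi_sub p_cov) xi /(voronoi_sub p_cov) yi.
  have := metric_triangle (x : X) (p i) (y : X).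
  by rewrite (metric_sym (x : X) (p i)); move: xi yi; rewrite /cball /=; lra.
- move=> i; rewrite -lee_fin fineK; last first.
    by rewrite fin_num_measure//; exact: voronoi_measurable.
  apply: le_trans (ahl_lower ahl (p i) _ _) _; [by lra|by lra|].
  apply: le_measure; rewrite ?inE; [exact: cball_measurable|exact: voronoi_measurable|].
  exact: sub_voronoi.
exists (size sq), w; split.
  rewrite le_max; apply/orP; right.
  have := mdist_separated_size ahl r0 rD sep; rewrite -ler_pdivlMr// => /le_trans; apply.
  have -> : m / (c * (r / 3) `^ df) = A3 * r `^ (- df).
    rewrite r3 powRN /A3; field.
    by rewrite !gt_eqF// powR_gt0.
  by rewrite ler_wpM2r// powR_ge0.
move=> f fin; apply: (le_trans (hw f fin)); rewrite lerD2r.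
rewrite [leRHS]mulrA ler_wpM2r//.
have -> : (2 * r) `^ s / (2 * (c * (r / 3) `^ df)) = A1 * r `^ (2 * a) / 2.
  rewrite powRM ?ltW// r3 [X in _ * X / _]powRD ?(gt_eqF r0) ?implybT// /A1; field.
  by rewrite !gt_eqF// powR_gt0.
by rewrite ler_pM2r ?invr_gt0// ler_wpM2r// powR_ge0.
Qed.

End TestFunctions.

(** * Tent functions *)

Lemma exprn_powR (R : realType) (a p : R) n : 0 <= a -> (a ^+ n) `^ p = (a `^ p) ^+ n.
Proof. by move=> a0; rewrite -!powR_mulrn ?powR_ge0// powRAC. Qed.

Section Kernel.
Context (R : realType) (X : pmetricType R).
Variable mu : {finite_measure set (borel X) -> \bar R}.
Variables df c C D : R.
Hypothesis ahl : ahlfors mu df c C D.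

(* Dominates the Gagliardo quotient of every 1-Lipschitz function with values
   in [0, r]. *)
Definition tent_kernel (s r : R) (x y : borel X) : R :=
  Num.min (mdist (x : X) (y : X) ^+ 2) (r ^+ 2) / mdist (x : X) (y : X) `^ s.

Lemma tent_kernel_ge0 s r x y : 0 <= tent_kernel s r x y.
Proof. by rewrite divr_ge0 ?powR_ge0// le_min !sqr_ge0. Qed.

Lemma tent_kernelC s r x y : tent_kernel s r x y = tent_kernel s r y x.
Proof. by rewrite /tent_kernel metric_sym. Qed.

Lemma measurable_tent_kernel s r :
  measurable_fun setT (fun z : borel X * borel X => tent_kernel s r z.1 z.2).
Proof.
apply: measurable_funM.
  apply: measurable_minr; last exact: measurable_cst.
  by apply: measurable_funX; exact: mdist_measurable ahl.
rewrite (_ : (fun z => _) = (fun z : borel X * borel X =>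
    mdist (z.1 : X) (z.2 : X) `^ (- s))); last first.
  by apply/funext => z; rewrite powRN.
exact: (measurableT_comp (@measurable_powR R (- s)) (mdist_measurable ahl)).
Qed.

(** Each [y] lies in a dyadic annulus around [x], where the distance is at least half the outer
    radius. Within distance [r] the radii shrink and the minimum is the squared distance; beyond,
    they grow and it is [r ^+ 2]. One index serves both families, so that a single series dominates
    the kernel. *)
Lemma tent_kernel_dyadic s r x y : 0 < s -> 0 < r ->
  let t n := 2^-1 ^+ n * r in let t' n := 2 ^+ n * r in
  exists n, tent_kernel s r x y <=
    t n ^+ 2 * (t n / 2) `^ (- s) * \1_(cball x (t n)) y +
    r ^+ 2 * (t' n / 2) `^ (- s) * \1_(cball x (t' n)) y.
Proof.
move=> s0 r0 t t'.
have t0 n : 0 < t n by rewrite mulr_gt0// exprn_gt0// invr_gt0.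
have t'0 n : 0 < t' n by rewrite mulr_gt0// exprn_gt0.
have pw u v : 0 < u -> u <= v -> v `^ (- s) <= u `^ (- s).
  move=> u0 uv; have v0 := lt_le_trans u0 uv.
  rewrite !powRN lef_pV2 ?posrE ?powR_gt0//.
  by rewrite ge0_ler_powR ?nnegrE ?(ltW s0) ?(ltW u0) ?(ltW v0).
rewrite /tent_kernel -powRN; set d := mdist (x : X) (y : X).
(* At distance 0 the kernel is 0 by the convention for [0] to a nonzero power. *)
have := mdist_ge0 (x : X) (y : X); rewrite -/d le_eqVlt => /orP[/eqP <-|d0].
  exists 0%N; rewrite powR0 ?mulr0; last by rewrite oppr_eq0 gt_eqF.
  by rewrite addr_ge0// mulr_ge0 ?indicE// mulr_ge0 ?sqr_ge0 ?powR_ge0.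
have [dr|rd] := leP d r.
- have [N0 hN0] : exists n, t n < d.
    have [n hn] := exists_half_exp_lt (divr_gt0 d0 r0).
    by exists n; rewrite /t -ltr_pdivlMr.
  have ex : exists n, (fun n => t n < d) n by exists N0.
  (* The least index is not 0, as [t 0 = r] is not below [d]; its predecessor [n] satisfies
     [t n.+1 < d <= t n]. *)
  case: (ex_minnP ex) => -[|n] tn nmin.
    by move: tn; rewrite /t expr0 mul1r ltNge dr.
  have dt : d <= t n by rewrite leNgt; apply/negP => /nmin; rewrite ltnn.
  have td : t n / 2 <= d.
    by move: tn; rewrite /t exprS => h; rewrite ltW//; apply: le_lt_trans h; lra.
  exists n.
  rewrite [X in X * _ + _]mulrC ler_wpDr//.
    by rewrite mulr_ge0 ?indicE// mulr_ge0 ?sqr_ge0 ?powR_ge0.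
  rewrite indicE mem_set// mulr1 [leRHS]mulrC.
  apply: ler_pM; rewrite ?powR_ge0 ?le_min ?sqr_ge0//.
  - rewrite ge_min; apply/orP; left.
    by rewrite lerXn2r ?nnegrE ?(ltW d0) ?(ltW (t0 _)).
  - by apply: pw => //; rewrite divr_gt0.
- have [N0 hN0] : exists n, d <= t' n.
    have [n hn] := exists_half_exp_lt (divr_gt0 r0 d0).
    exists n; rewrite /t' -ler_pdivrMl ?exprn_gt0// -exprVn.
    by rewrite -ler_pdivlMr// ltW.
  have ex : exists n, (fun n => d <= t' n) n by exists N0.
  case: (ex_minnP ex) => -[|n] tn nmin.
    by move: tn; rewrite /t' expr0 mul1r leNgt rd.
  have td : t' n.+1 / 2 <= d.
    have : t' n <= d by rewrite leNgt; apply/negP => /ltW/nmin; rewrite ltnn.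
    by rewrite /t' exprS => h; apply: le_trans h; lra.
  exists n.+1.
  rewrite ler_wpDl//.
    by rewrite mulr_ge0 ?indicE// mulr_ge0 ?sqr_ge0 ?powR_ge0.
  rewrite indicE mem_set// mulr1.
  apply: ler_pM; rewrite ?powR_ge0 ?le_min ?sqr_ge0//.
  - by rewrite ge_min lexx orbT.
  - by apply: pw => //; rewrite divr_gt0.
Qed.

(** Up to constants, a near annulus of radius [t] contributes [t ^ (2 - 2a)] and a far one
    [r ^ 2 * t ^ (-2a)]. The near series converges because [a < 1], the far one because [0 < a]. *)
Lemma tent_kernel_bound (a : R) : 0 < a -> a < 1 -> exists2 M, 0 < M &
  forall r x, 0 < r ->
    (\int[mu]_y (tent_kernel (df + 2 * a) r x y)%:E <= (M * r `^ (2 - 2 * a))%:E)%E.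
Proof.
move=> a0 a1; pose s := df + 2 * a; have df0 := ahl_df ahl; have C0 := ahl_C ahl.
have s0 : 0 < s by rewrite addr_gt0// mulr_gt0.
pose q1 : R := 2^-1 `^ (2 - 2 * a); pose q2 : R := 2^-1 `^ (2 * a).
pose q := Num.max q1 q2.
have half_pow (p : R) : 0 < p -> 2^-1 `^ p < 1.
  move=> p0; rewrite [ltRHS](_ : 1 = 1 `^ p :> R); last by rewrite powR1.
  by rewrite gt0_ltr_powR ?nnegrE ?invr_ge0// invf_lt1 ?ltr1n.
have q1_lt : q < 1 by rewrite gt_max !half_pow//; lra.
have q_ge0 : 0 <= q by rewrite le_max powR_ge0.
pose K := C * 2 `^ s.
have K0 : 0 < K by rewrite mulr_gt0// powR_gt0.
exists (2 * K / (1 - q)); first by rewrite divr_gt0 ?mulr_gt0//; lra.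
move=> r x r0.
pose t n := 2^-1 ^+ n * r; pose t' n := 2 ^+ n * r.
have t0 n : 0 < t n by rewrite mulr_gt0// exprn_gt0// invr_gt0.
have t'0 n : 0 < t' n by rewrite mulr_gt0// exprn_gt0.
pose v n := t n ^+ 2 * (t n / 2) `^ (- s).
pose v' n := r ^+ 2 * (t' n / 2) `^ (- s).
have v0 n : 0 <= v n by rewrite mulr_ge0 ?sqr_ge0 ?powR_ge0.
have v'0 n : 0 <= v' n by rewrite mulr_ge0 ?sqr_ge0 ?powR_ge0.
pose u n y := ((v n)%:E * (\1_(cball x (t n)) y)%:E +
  (v' n)%:E * (\1_(cball x (t' n)) y)%:E)%E.
have ind_meas rho : measurable_fun setT (fun y : borel X => (\1_(cball x rho) y : R)%:E).
  by apply/measurable_EFinP; apply: measurable_indic; exact: cball_measurable.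
have ind0 rho y : (0 <= (\1_(cball x rho) y : R)%:E)%E by rewrite lee_fin indicE.
have u0 n y : (0 <= u n y)%E.
  by rewrite adde_ge0// mule_ge0// ?lee_fin ?indicE.
have mU n : measurable_fun setT (u n).
  by apply: emeasurable_funD; apply: measurable_funeM.
(* Kernel bound on the annulus of outer radius [w] times the measure bound of the ball. *)
have pow_ann w : 0 < w -> (w / 2) `^ (- s) * (C * w `^ df) = K * w `^ (- (2 * a)).
  move=> w0; rewrite powRM ?ltW// -{1}[2^-1]powR_inv1// -powRrM mulN1r opprK.
  rewrite (_ : - s = - (2 * a) - df); last by rewrite /s; ring.
  rewrite powRD ?(gt_eqF w0) ?implybT// [w `^ (- df)]powRN /K; field.
  by rewrite gt_eqF// powR_gt0.
have ind_int rho w : 0 <= w -> 0 < rho ->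
   (\int[mu]_y (w%:E * (\1_(cball x rho) y)%:E) <= (w * (C * rho `^ df))%:E)%E.
  move=> w0 rho0; rewrite ge0_integralZl_EFin// integral_indic//; last exact: cball_measurable.
  rewrite setIT EFinM lee_wpmul2l ?lee_fin//.
  by apply: (ahl_upper ahl); exact: ltW.
have int_u n : (\int[mu]_y u n y <= ((2 * K * r `^ (2 - 2 * a)) * q ^+ n)%:E)%E.
  rewrite ge0_integralD//; last 4 first.
  - by move=> y _; rewrite mule_ge0// lee_fin.
  - exact: measurable_funeM.
  - by move=> y _; rewrite mule_ge0// lee_fin.
  - exact: measurable_funeM.
  apply: (le_trans (leeD (ind_int _ _ (v0 n) (t0 n)) (ind_int _ _ (v'0 n) (t'0 n)))).
  rewrite -EFinD lee_fin.
  have -> : v n * (C * t n `^ df) = K * r `^ (2 - 2 * a) * q1 ^+ n.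
    rewrite /v -(mulrA (t n ^+ 2)) pow_ann//.
    rewrite mulrCA -(@powR_mulrn R (t n) 2 (ltW (t0 n))) -powRD ?(gt_eqF (t0 n)) ?implybT//.
    rewrite powRM ?exprn_ge0 ?invr_ge0 ?(ltW r0)// exprn_powR ?invr_ge0//.
    by rewrite -/q1; ring.
  have -> : v' n * (C * t' n `^ df) = K * r `^ (2 - 2 * a) * q2 ^+ n.
    rewrite /v' -(mulrA (r ^+ 2)) pow_ann//.
    rewrite powRM ?exprn_ge0 ?(ltW r0)// exprn_powR//.
    rewrite (_ : 2 `^ (- (2 * a)) = q2); last first.
      by rewrite /q2 -[2^-1]powR_inv1// -powRrM mulN1r.
    rewrite powRD ?(gt_eqF r0) ?implybT// (@powR_mulrn R r 2 (ltW r0)); ring.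
  have q1q : q1 ^+ n <= q ^+ n by rewrite lerXn2r ?nnegrE ?powR_ge0// le_max lexx.
  have q2q : q2 ^+ n <= q ^+ n.
    by rewrite lerXn2r ?nnegrE ?powR_ge0// le_max lexx orbT.
  have P0 : 0 <= K * r `^ (2 - 2 * a) by rewrite mulr_ge0 ?powR_ge0 ?ltW.
  have := ler_wpM2l P0 q1q; have := ler_wpM2l P0 q2q; lra.
have kernel_le y : ((tent_kernel s r x y)%:E <= \sum_(0 <= n <oo) u n y)%E.
  have [n hn] := @tent_kernel_dyadic s r x y s0 r0.
  apply: (@le_trans _ _ (u n y)); first by rewrite /u -!EFinM -EFinD lee_fin.
  apply: (@le_trans _ _ (\sum_(0 <= k < n.+1) u k y)%E).
    by rewrite big_nat_recr//= leeDr// sume_ge0.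
  exact: nneseries_lim_ge.
apply: (@le_trans _ _ (\int[mu]_y \sum_(0 <= n <oo) u n y)%E).
  apply: ge0_le_integral => //.
  - by move=> y _; rewrite lee_fin tent_kernel_ge0.
  - apply/measurable_EFinP.
    exact: (measurableT_comp (measurable_tent_kernel s r) (pair1_measurable x)).
  - by apply: ge0_emeasurable_sum => //.
rewrite integral_nneseries//.
have -> : 2 * K / (1 - q) * r `^ (2 - 2 * a) = (2 * K * r `^ (2 - 2 * a)) / (1 - q).
  by rewrite mulrAC.
apply: nneseries_geometric_le => //.
- by rewrite mulr_ge0 ?powR_ge0// mulr_ge0// ltW.
- by move=> n; apply: integral_ge0.
Qed.

End Kernel.

(** At most one tent is nonzero at [x] and at most one at [y], so differences of combinations have
    at most two terms; the constant 2 does not grow with [N]. *)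
Lemma sqr_sum_two (R : realType) (N : nat) (z : 'I_N -> R) (i0 j0 : 'I_N) :
  (forall i, i != i0 -> i != j0 -> z i = 0) ->
  (\sum_i z i) ^+ 2 <= 2 * \sum_i z i ^+ 2.
Proof.
move=> z0.
have sumE (g : R -> R) : g 0 = 0 -> \sum_i g (z i) =
    g (z i0) + (if i0 == j0 then 0 else g (z j0)).
  move=> g0; rewrite (bigD1 i0)//=; congr (_ + _).
  have [i0j0|i0j0] := eqVneq i0 j0.
    by rewrite big1// => i ii0; rewrite z0// -i0j0.
  rewrite (bigD1 j0) 1?eq_sym//= big1 ?addr0// => i /andP[ii0 ij0].
  by rewrite z0.
rewrite (sumE id)// (sumE (fun t => t ^+ 2)) ?expr0n//; case: ifP => _.
  by rewrite !addr0 ler_peMl ?sqr_ge0// ler1n.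
by have := sqr_ge0 (z i0 - z j0); nra.
Qed.

Lemma exists_at_most_one (R : realType) (N : nat) (u : 'I_N -> R) :
  (0 < N)%N -> (forall i j, i != j -> u i * u j = 0) ->
  exists i0, forall i, i != i0 -> u i = 0.
Proof.
move=> N0 u0; have [i0 ui0|u_eq0] := pickP (fun i => u i != 0).
  exists i0 => i /u0/eqP; rewrite mulf_eq0 (negbTE ui0) orbF; exact/eqP.
by exists (Ordinal N0) => i _; have /negbFE/eqP := u_eq0 i.
Qed.

Lemma L2_sumE d (T : measurableType d) (R : realType) (mu : {measure set T -> \bar R})
    (I : Type) (r : seq I) (a : I -> R) (u : I -> L2 mu) (x : T) :
  (\sum_(i <- r) a i *: u i) x = \sum_(i <- r) a i * u i x.
Proof.
elim: r => [|i r IH]; first by rewrite !big_nil.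
by rewrite !big_cons -IH.
Qed.

Section Tents.
Context (R : realType) (X : pmetricType R).
Variable mu : {finite_measure set (borel X) -> \bar R}.
Variables df c C D : R.
Hypothesis ahl : ahlfors mu df c C D.

Definition tent (p : X) (r : R) (x : borel X) : R := Num.max 0 (r - mdist p (x : X)).

Lemma tent_ge0 p r x : 0 <= tent p r x.
Proof. by rewrite le_max lexx. Qed.

Lemma tent_le p r x : 0 <= r -> tent p r x <= r.
Proof. by move=> r0; rewrite ge_max r0 gerBl mdist_ge0. Qed.

Lemma tent_out p r x : r <= mdist p (x : X) -> tent p r x = 0.
Proof. by move=> h; apply/max_idPl; rewrite subr_le0. Qed.

Lemma tent_lipschitz p r x y : `|tent p r x - tent p r y| <= mdist (x : X) (y : X).
Proof.
have h1 := metric_triangle p (x : X) (y : X).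
have h2 := metric_triangle p (y : X) (x : X); rewrite (metric_sym (y : X) (x : X)) in h2.
have h0 := mdist_ge0 (x : X) (y : X).
rewrite ler_norml /tent; apply/andP; split.
  by case: (leP 0 (r - mdist p (x : X))) => ?; case: (leP 0 (r - mdist p (y : X))) => ?; lra.
by case: (leP 0 (r - mdist p (x : X))) => ?; case: (leP 0 (r - mdist p (y : X))) => ?; lra.
Qed.

Lemma measurable_tent p r : measurable_fun setT (tent p r).
Proof.
apply: measurable_maxr; first exact: measurable_cst.
by apply: measurable_funB; [exact: measurable_cst|exact: measurable_mdist].
Qed.

Lemma tent_L2 p r : 0 <= r -> exists u : L2 mu, u =1 tent p r.
Proof.
move=> r0; apply: L2_of_fun; first exact: measurable_tent.
apply: (@le_lt_trans _ _ (\int[mu]_x (cst (r ^+ 2)%:E x))%E); last first.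
  by rewrite integral_cst// ltey_eq fin_numM// fin_num_measure.
apply: ge0_le_integral => //.
- by move=> x _; rewrite lee_fin sqr_ge0.
- by apply/measurable_EFinP; apply: measurable_funX; exact: measurable_tent.
- move=> x _; rewrite lee_fin lerXn2r ?nnegrE ?tent_ge0//.
  exact: tent_le.
Qed.

(** The quotient vanishes unless [x] or [y] lies in the supporting ball. *)
Lemma tent_gagliardo s p r x y : 0 <= r -> gagliardo s (tent p r) x y <=
  tent_kernel s r x y * \1_(cball p r) x + tent_kernel s r x y * \1_(cball p r) y.
Proof.
move=> r0; set b := tent p r.
have k0 := tent_kernel_ge0 s r x y.
have qk : gagliardo s b x y <= tent_kernel s r x y.
  rewrite ler_wpM2r ?invr_ge0 ?powR_ge0// -[(b x - b y) ^+ 2]real_normK ?num_real// le_min.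
  apply/andP; split; rewrite lerXn2r ?nnegrE ?mdist_ge0//.
    exact: tent_lipschitz.
  rewrite ler_norml; have := tent_ge0 p r x; have := tent_ge0 p r y.
  by have := tent_le p x r0; have := tent_le p y r0; rewrite -/b; lra.
have b0 z : z \notin cball p r -> b z = 0.
  move=> zp; apply: tent_out; move: zp; rewrite notin_setE /cball /= => /negP.
  by rewrite -ltNge => /ltW.
rewrite !indicE; have [xp|xp] := boolP (x \in cball p r).
  by rewrite mulr1 ler_wpDr// mulr_ge0.
have [yp|yp] := boolP (y \in cball p r); first by rewrite mulr0 add0r mulr1.
by rewrite /gagliardo !b0// subrr expr0n mul0r !mulr0 addr0.
Qed.

Lemma tent_energy s M p r : 0 <= r -> 0 <= M ->
  (forall x, (\int[mu]_y (tent_kernel s r x y)%:E <= M%:E)%E) ->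
  (energy mu s (tent p r) <= (2 * M * (C * r `^ df))%:E)%E.
Proof.
move=> r0 M0 hM; have mB := cball_measurable p r.
pose Z (z : borel X * borel X) :=
  ((tent_kernel s r z.1 z.2)%:E * (\1_(cball p r) z.1)%:E)%E.
have Z0 z : (0 <= Z z)%E by rewrite mule_ge0 ?lee_fin ?tent_kernel_ge0 ?indicE.
have mind : measurable_fun setT (fun x : borel X => (\1_(cball p r) x : R)%:E).
  by apply/measurable_EFinP; apply: measurable_indic.
have mK : measurable_fun setT (fun z : borel X * borel X => (tent_kernel s r z.1 z.2)%:E).
  by apply/measurable_EFinP; exact: measurable_tent_kernel ahl s r.
have mZ : measurable_fun setT Z.
  apply: emeasurable_funM => //; exact: (measurableT_comp mind measurable_fst).
pose Z' (z : borel X * borel X) := Z (z.2, z.1).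
have mZ' : measurable_fun setT Z'.
  apply: (measurableT_comp mZ); apply: measurable_fun_pair => /=.
    exact: measurable_snd.
  exact: measurable_fst.
have Z'0 z : (0 <= Z' z)%E by exact: Z0.
have ZE x y : Z (x, y) = ((\1_(cball p r) x)%:E * (tent_kernel s r x y)%:E)%E.
  by rewrite /Z muleC.
have intZ : (\int[mu]_x \int[mu]_y Z (x, y) <= (M * (C * r `^ df))%:E)%E.
  apply: (@le_trans _ _ (\int[mu]_x (M%:E * (\1_(cball p r) x)%:E))%E).
    apply: ge0_le_integral => //.
    - by move=> x _; exact: integral_ge0.
    - exact: (measurable_fun_fubini_tonelli_F (m2 := mu) _ mZ Z0).
    - exact: measurable_funeM.
    - move=> x _; under eq_integral do rewrite ZE.
      rewrite ge0_integralZl_EFin ?indicE//; last 2 first.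
      + by move=> y _; rewrite lee_fin tent_kernel_ge0.
      + exact: (measurableT_comp mK (pair1_measurable x)).
      by rewrite muleC lee_wpmul2r ?lee_fin.
  rewrite ge0_integralZl_EFin//.
  rewrite integral_indic// setIT EFinM lee_wpmul2l ?lee_fin//.
  exact: (ahl_upper ahl).
have intZ' : (\int[mu]_x \int[mu]_y Z' (x, y) <= (M * (C * r `^ df))%:E)%E.
  (* Exchanging the integrals turns the second term into the first. *)
  rewrite (fubini_tonelli (m1 := mu) (m2 := mu) Z' mZ' Z'0); exact: intZ.
apply: (@le_trans _ _
  (\int[mu]_x ((\int[mu]_y Z (x, y)) + (\int[mu]_y Z' (x, y)))%E)%E).
  apply: ge0_le_integral => //.
  - move=> x _; apply: integral_ge0 => y _; by rewrite lee_fin gagliardo_ge0.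
  - apply: measurable_energy_density; first exact: mdist_measurable ahl.
    exact: measurable_tent.
  - apply: emeasurable_funD.
      exact: (measurable_fun_fubini_tonelli_F (m2 := mu) _ mZ Z0).
    exact: (measurable_fun_fubini_tonelli_F (m2 := mu) _ mZ' Z'0).
  - move=> x _; rewrite -ge0_integralD//; last 2 first.
    + exact: (measurableT_comp mZ (pair1_measurable x)).
    + exact: (measurableT_comp mZ' (pair1_measurable x)).
    apply: ge0_le_integral => //.
    + by move=> y _; rewrite lee_fin gagliardo_ge0.
    + apply: measurable_gagliardo_section; first exact: mdist_measurable ahl.
      exact: measurable_tent.
    + apply: emeasurable_funD.
        exact: (measurableT_comp mZ (pair1_measurable x)).
      exact: (measurableT_comp mZ' (pair1_measurable x)).
    + move=> y _; rewrite /Z' /Z/= -!EFinM -EFinD lee_fin (tent_kernelC s r y x).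
      exact: tent_gagliardo.
rewrite ge0_integralD//; last 4 first.
- by move=> x _; exact: integral_ge0.
- exact: (measurable_fun_fubini_tonelli_F (m2 := mu) _ mZ Z0).
- by move=> x _; exact: integral_ge0.
- exact: (measurable_fun_fubini_tonelli_F (m2 := mu) _ mZ' Z'0).
rewrite (le_trans (leeD intZ intZ'))// -EFinD lee_fin; lra.
Qed.

Section Combination.
Variables (N : nat) (p : 'I_N -> X) (r : R).
Hypothesis r_gt0 : 0 < r.
Hypothesis p_sep : forall i j : 'I_N, i != j -> 2 * r <= mdist (p i) (p j).
Variable u : 'I_N -> L2 mu.
Hypothesis uE : forall i, u i =1 tent (p i) r.
Variable e : 'I_N -> R.

Let f : L2 mu := \sum_i e i *: u i.

Let fE x : f x = \sum_i e i * tent (p i) r x.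
Proof. by rewrite L2_sumE; apply: eq_bigr => i _; rewrite uE. Qed.

Let tent_disjoint x i j : i != j -> tent (p i) r x * tent (p j) r x = 0.
Proof.
move=> /p_sep pij; have [h|h] := leP r (mdist (p i) (x : X)).
  by rewrite tent_out// mul0r.
rewrite (@tent_out (p j)) ?mulr0//.
have := metric_triangle (p i) (x : X) (p j); rewrite (metric_sym (x : X)); lra.
Qed.

Lemma tent_sum_gagliardo s x y : gagliardo s f x y <=
  \sum_i 2 * e i ^+ 2 * gagliardo s (tent (p i) r) x y.
Proof.
have [N0|N0] := posnP N.
  suff fz z : f z = 0.
    rewrite /gagliardo !fz subrr expr0n mul0r sumr_ge0// => i _.
    apply: mulr_ge0; first by apply: mulr_ge0 => //; exact: sqr_ge0.
    exact: gagliardo_ge0.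
  by rewrite fE big1// => -[i iN]; exfalso; move: iN; rewrite N0.
rewrite /gagliardo; under eq_bigr do rewrite mulrA.
rewrite -mulr_suml ler_wpM2r ?invr_ge0 ?powR_ge0//.
have [i0 hi0] := exists_at_most_one N0 (tent_disjoint x).
have [j0 hj0] := exists_at_most_one N0 (tent_disjoint y).
rewrite !fE -sumrB.
under eq_bigr do rewrite -mulrBr.
rewrite (le_trans (@sqr_sum_two _ _ _ i0 j0 _))//.
  by move=> i ii0 ij0; rewrite hi0// hj0// subrr mulr0.
rewrite mulr_sumr; apply: ler_sum => i _.
by rewrite exprMn mulrA.
Qed.

Lemma tent_sum_energy s M : 0 <= M ->
  (forall x, (\int[mu]_y (tent_kernel s r x y)%:E <= M%:E)%E) ->
  (energy mu s f <= (4 * M * (C * r `^ df) * \sum_i e i ^+ 2)%:E)%E.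
Proof.
move=> M0 hM; have mG i := measurable_gagliardo (mdist_measurable ahl) s (measurable_tent (p i) r).
have mg i x : measurable_fun setT (fun y => (gagliardo s (tent (p i) r) x y)%:E).
  exact: (measurableT_comp (mG i) (pair1_measurable x)).
have md i := measurable_energy_density mu (mdist_measurable ahl) s (measurable_tent (p i) r).
have e0 i : 0 <= 2 * e i ^+ 2 by rewrite mulr_ge0 ?sqr_ge0.
have inner x : (\int[mu]_y (gagliardo s f x y)%:E <= \sum_i (2 * e i ^+ 2)%:E *
    \int[mu]_y (gagliardo s (tent (p i) r) x y)%:E)%E.
  apply: (@le_trans _ _ (\int[mu]_y \sum_i (2 * e i ^+ 2)%:E *
      (gagliardo s (tent (p i) r) x y)%:E)%E).
    apply: ge0_le_integral => //.
    - by move=> y _; rewrite lee_fin gagliardo_ge0.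
    - apply: measurable_gagliardo_section; first exact: mdist_measurable ahl.
      exact: measurable_L2.
    - by apply: emeasurable_sum => i; exact: measurable_funeM.
    - move=> y _; under eq_bigr do rewrite -EFinM.
      by rewrite sumEFin lee_fin; exact: tent_sum_gagliardo.
  rewrite ge0_integral_sum//; last 2 first.
  - by move=> i; exact: measurable_funeM.
  - by move=> i y _; rewrite mule_ge0 ?lee_fin ?gagliardo_ge0.
  apply: lee_sum => i _; rewrite ge0_integralZl_EFin//.
  by move=> y _; rewrite lee_fin gagliardo_ge0.
apply: (@le_trans _ _ (\int[mu]_x \sum_i (2 * e i ^+ 2)%:E *
    \int[mu]_y (gagliardo s (tent (p i) r) x y)%:E)%E).
  apply: ge0_le_integral => //.
  - by move=> x _; apply: integral_ge0 => y _; rewrite lee_fin gagliardo_ge0.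
  - apply: measurable_energy_density; first exact: mdist_measurable ahl.
    exact: measurable_L2.
  - by apply: emeasurable_sum => i; exact: measurable_funeM.
rewrite ge0_integral_sum//; last 2 first.
- by move=> i; exact: measurable_funeM.
- move=> i x _; rewrite mule_ge0 ?lee_fin//; apply: integral_ge0 => y _.
  by rewrite lee_fin gagliardo_ge0.
apply: (@le_trans _ _ (\sum_i ((2 * e i ^+ 2) * (2 * M * (C * r `^ df)))%:E)%E).
  apply: lee_sum => i _; rewrite ge0_integralZl_EFin//; last first.
    by move=> x _; apply: integral_ge0 => y _; rewrite lee_fin gagliardo_ge0.
  by rewrite [leRHS]EFinM lee_wpmul2l ?lee_fin//; apply: tent_energy => //; exact: ltW.
rewrite sumEFin lee_fin -mulr_suml -mulr_sumr; lra.
Qed.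

(** Disjoint supports remove the cross terms, and each tent is at least [r / 2] on the ball of half
    its radius. *)
Lemma tent_sum_norm : r / 2 < D ->
  (r / 2) ^+ 2 * (c * (r / 2) `^ df) * \sum_i e i ^+ 2 <= L2dot f f.
Proof.
move=> rD.
have fsq x : f x ^+ 2 = \sum_i e i ^+ 2 * tent (p i) r x ^+ 2.
  rewrite fE expr2 mulr_suml; apply: eq_bigr => i _.
  rewrite mulr_sumr (bigD1 i)//= big1 ?addr0 => [|j ji]; first by ring.
  rewrite mulrACA [X in _ * X](tent_disjoint x) ?mulr0//.
  by rewrite eq_sym.
rewrite -lee_fin EFin_L2dot; under [leRHS]eq_integral do rewrite fsq -sumEFin.
have mb i : measurable_fun setT (EFin \o (fun x => e i ^+ 2 * tent (p i) r x ^+ 2)).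
  apply/measurable_EFinP; apply: measurable_funM => //.
  by apply: measurable_funX; exact: measurable_tent.
rewrite ge0_integral_sum//; last first.
  by move=> i x _; rewrite lee_fin mulr_ge0 ?sqr_ge0.
rewrite mulr_sumr -sumEFin; apply: lee_sum => i _.
have mB := cball_measurable (p i) (r / 2).
apply: (@le_trans _ _ (\int[mu]_x ((e i ^+ 2 * (r / 2) ^+ 2)%:E *
    (\1_(cball (p i) (r / 2)) x)%:E))%E).
  rewrite ge0_integralZl_EFin//; last 2 first.
  - by apply/measurable_EFinP; apply: measurable_indic.
  - by rewrite mulr_ge0 ?sqr_ge0.
  rewrite integral_indic// setIT.
  rewrite (_ : _ * e i ^+ 2 = e i ^+ 2 * (r / 2) ^+ 2 * (c * (r / 2) `^ df)); last by ring.
  rewrite [leLHS]EFinM lee_wpmul2l//.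
    by rewrite lee_fin mulr_ge0 ?sqr_ge0.
  by apply: (ahl_lower ahl) => //; rewrite divr_ge0// ltW.
apply: ge0_le_integral => //.
- by move=> x _; rewrite mule_ge0 ?lee_fin ?indicE// mulr_ge0 ?sqr_ge0.
- apply: measurable_funeM; apply/measurable_EFinP; exact: measurable_indic.
- exact: mb.
- move=> x _; rewrite -EFinM lee_fin -mulrA ler_wpM2l ?sqr_ge0// indicE.
  have [xB|_] := boolP (x \in _); last by rewrite mulr0 sqr_ge0.
  have r20 : 0 <= r / 2 by rewrite divr_ge0// ltW.
  rewrite mulr1 lerXn2r ?nnegrE ?tent_ge0//.
  move: xB; rewrite inE /cball /= /tent le_max => xB.
  by apply/orP; right; lra.
Qed.

End Combination.

End Tents.

(** * Trial spaces spanned by tents *)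

Section TrialSpace.
Context (R : realType) (X : pmetricType R).
Variable mu : {finite_measure set (borel X) -> \bar R}.
Variables df c C D : R.
Hypothesis ahl : ahlfors mu df c C D.

Lemma net_size r s : 0 < r -> (forall x : X, exists2 y, y \in s & mdist x y < r) ->
  fine (mu setT) <= (size s)%:R * (C * r `^ df).
Proof.
move=> r0 cov; rewrite -lee_fin fineK ?fin_num_measure//.
have mB i : measurable (cball (nth (point : X) s i) r) by exact: cball_measurable.
apply: (@le_trans _ _ (\sum_(i < size s) mu (cball (nth (point : X) s i) r))%E).
  apply: (@content_subadditive _ _ _ mu setT (fun i => cball (nth (point : X) s i) r)) => //.
  move=> x _; have [y ys xy] := cov x.
  rewrite -(bigcup_mkord _ (fun i => cball (nth (point : X) s i) r)).
  exists (index y s); first by rewrite /= index_mem.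
  by rewrite /cball /= nth_index// metric_sym ltW.
apply: (@le_trans _ _ (\sum_(i < size s) (C * r `^ df)%:E)%E).
  by apply: lee_sum => i _; apply: (ahl_upper ahl); exact: ltW.
by rewrite sumEFin sumr_const card_ord mulr_natl.
Qed.

Lemma trial_space (a : R) : 0 < a -> a < 1 -> exists b B, [/\ 0 < b, 0 < B &
  forall r, 0 < r -> 2 * r < D -> exists N (u : 'I_N -> L2 mu),
    [/\ b * r `^ (- df) <= N%:R,
        forall i, (energy mu (df + 2 * a) (u i) < +oo)%E &
        forall e : 'I_N -> R, let f : L2 mu := \sum_i e i *: u i in
          ((exists i, e i != 0) -> 0 < L2dot f f) /\
          2^-1 * fine (energy mu (df + 2 * a) f) <= B * r `^ (- (2 * a)) * L2dot f f]].
Proof.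
move=> a0 a1; have [M M0 hM] := tent_kernel_bound ahl a0 a1.
have df0 := ahl_df ahl; have c0 := ahl_c ahl; have C0 := ahl_C ahl.
have mass0 := total_mass_gt0 ahl; set m := fine (mu setT) in mass0.
(* The first constant counts the points of a [2 * r]-net by covering; the second is the quotient of
   the bounds in [tent_sum_energy] and [tent_sum_norm]. *)
exists (m / (C * 2 `^ df)), (8 * M * C * 2 `^ df / c); split.
- by rewrite divr_gt0// mulr_gt0// powR_gt0.
- by rewrite divr_gt0// !mulr_gt0// powR_gt0.
move=> r r0 rD.
have r20 : 0 < 2 * r by rewrite mulr_gt0.
have [sq sep cov] := exists_net ahl r20 rD.
pose p (i : 'I_(size sq)) := nth (point : X) sq i.
have p_sep (i j : 'I_(size sq)) : i != j -> 2 * r <= mdist (p i) (p j).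
  by move=> ij; apply: mdist_separated_nth sep _ _ _.
have /choice[u uE] := fun i => tent_L2 mu (p i) (ltW r0).
have hM' x := hM r x r0.
have Mr0 : 0 <= M * r `^ (2 - 2 * a) by rewrite mulr_ge0 ?powR_ge0// ltW.
exists (size sq), u; split.
- have := net_size r20 cov; rewrite -ler_pdivrMr; last first.
    by rewrite mulr_gt0// powR_gt0.
  apply: le_trans; rewrite le_eqVlt; apply/orP; left; apply/eqP.
  rewrite powRM ?ltW// powRN -/m; field.
  by rewrite !gt_eqF// powR_gt0.
- move=> i; have uiE : u i = tent (p i) r :> (_ -> _) by apply/funext; exact: uE.
  rewrite uiE; apply: (le_lt_trans (tent_energy ahl (p i) (ltW r0) Mr0 hM')).
  by rewrite ltry.
move=> e f.
have r2D : r / 2 < D by lra.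
have norm := tent_sum_norm ahl r0 p_sep uE e r2D; rewrite -/f in norm.
have en := tent_sum_energy ahl r0 p_sep uE e Mr0 hM'; rewrite -/f in en.
have r2p : 0 < (r / 2) ^+ 2 * (c * (r / 2) `^ df).
  by rewrite mulr_gt0 ?exprn_gt0 ?divr_gt0// mulr_gt0 ?powR_gt0 ?divr_gt0.
split.
  move=> [i ei]; apply: lt_le_trans norm; rewrite mulr_gt0// (bigD1 i)//=.
  rewrite ltr_pwDl ?sumr_ge0//; last by move=> j _; exact: sqr_ge0.
  by rewrite lt_neqAle eq_sym sqrf_eq0 ei sqr_ge0.
apply: (@le_trans _ _ (2^-1 * (4 * (M * r `^ (2 - 2 * a)) * (C * r `^ df) *
    \sum_i e i ^+ 2))).
  rewrite ler_pM2l ?invr_gt0// -lee_fin fineK//.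
  rewrite ge0_fin_numE; first by rewrite (le_lt_trans en) ?ltry.
  apply: integral_ge0 => x _; apply: integral_ge0 => y _.
  by rewrite lee_fin gagliardo_ge0.
have B0 : 0 <= 8 * M * C * 2 `^ df / c * r `^ (- (2 * a)).
  by rewrite mulr_ge0 ?powR_ge0// divr_ge0 ?(ltW c0)// !mulr_ge0 ?powR_ge0 ?(ltW M0) ?(ltW C0).
apply: le_trans (ler_wpM2l B0 norm).
rewrite le_eqVlt; apply/orP; left; apply/eqP.
have -> : (r / 2) `^ df = r `^ df / 2 `^ df by exact: powR_div (ltW r0) _.
have -> : r `^ (2 - 2 * a) = r ^+ 2 * r `^ (- (2 * a)).
  by rewrite powRD ?(gt_eqF r0) ?implybT// (@powR_mulrn R r 2 (ltW r0)).
field.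
by rewrite !gt_eqF// powR_gt0.
Qed.

End TrialSpace.

(** * Eigenvalues of the fractional Dirichlet Laplacian *)

Section Operators.
Context d (T : measurableType d) (R : realType).
Variable mu : {finite_measure set T -> \bar R}.

Lemma sqrt_eigspaceE (A S : op_graph mu) : is_sqrt A S ->
  forall t, op_eigenspace A t = eigvec S t :> set _.
Proof.
by move=> [_ AS] t; apply/seteqP; split => f; [move/AS|move=> h; apply/AS].
Qed.

Lemma has_dim_basis (A S : op_graph mu) t k : is_sqrt A S ->
  has_dim (op_eigenspace A t) k ->
  exists phi : 'I_k -> L2 mu, eigspace_basis (@L2dot _ T R mu) S t phi.
Proof.
move=> AS [phi [eig free span]]; exists phi.
rewrite (sqrt_eigspaceE AS) in eig span.
split => //.
- by move=> e /L2dot_eq0; exact: free.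
- by move=> f /span[e fe]; exists e; apply/L2dot_sub_eq0.
Qed.

Lemma eigenvalue_sequence_enum (A S : op_graph mu) (lam : nat -> R) :
  is_sqrt A S -> eigenvalue_sequence A lam ->
  exists psi, eigen_enum (@L2dot _ T R mu) S lam psi.
Proof.
move=> AS [_ lamE]; have [[Sadj _] _] := AS; have {Sadj}[_ _ Sadj] := Sadj.
apply: (eigen_enum_exists (L2dot_psd mu) Sadj) => t.
by have [k dimk cardk] := lamE t; exists k => //; exact: has_dim_basis dimk.
Qed.

End Operators.

Section Laplacian.
Context (R : realType) (X : pmetricType R).
Variable mu : {finite_measure set (borel X) -> \bar R}.
Variables df alpha : R.

Let s := df + 2 * alpha.

Lemma HalphaE (f : L2 mu) : Halpha df alpha f = (energy mu s f < +oo)%E :> Prop.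
Proof.
rewrite /Halpha /=; congr (is_true (_ < _)%E).
by apply: eq_integral => x _; apply: eq_integral => y _; rewrite real_normK ?num_real.
Qed.

Lemma EalphaE (f : L2 mu) : Ealpha df alpha f f = 2^-1 * fine (energy mu s f).
Proof. by []. Qed.

(* On a one-point space all functions are proportional, whereas the [psi n]
   form an infinite free family. *)
Lemma diam_gt0_of_free (S : op_graph mu) lam psi : compact [set: X] ->
  eigen_enum (@L2dot _ _ R mu) S lam psi -> 0 < diam X.
Proof.
move=> cptX [_ free _]; rewrite ltNge; apply/negP => D0.
have bdd := mdist_le_diam cptX.
have xpt (x : X) : x = point.
  apply: mdist_positivity; apply/eqP; rewrite eq_le mdist_ge0 andbT.
  exact: le_trans (bdd _ _) D0.
have fE (f : L2 mu) (x : borel X) : f x = f (point : X) by rewrite (xpt x).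
pose v i := psi i (point : X).
have key (e : 'I_2 -> R) : \sum_i e i * v i = 0 -> forall i, e i = 0.
  move=> ev; apply: free; rewrite (_ : \sum_i _ = 0); first exact: (dot0l (L2dot_psd mu)).
  apply/LfuneqP => x; rewrite L2_sumE.
  by under eq_bigr => i _ do rewrite fE; exact: ev.
have v10 : v 1%N = 0.
  pose e (i : 'I_2) := if i == ord0 then v 1%N else - v 0%N.
  have : e ord0 = 0.
    by apply: key; rewrite big_ord_recl big_ord1 /e /= mulNr mulrC subrr.
  by rewrite /e eqxx.
have h : ((ord_max : 'I_2) == ord_max)%:R = 0 :> R.
  apply: (key (fun i => (i == ord_max)%:R)).
  by rewrite big_ord_recl big_ord1 /= mul0r add0r v10 mulr0.
by move/eqP: h; rewrite eqxx oner_eq0.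
Qed.

Section Bounds.
Variables (c C D : R).
Hypothesis ahl : ahlfors mu df c C D.
Hypotheses (alpha_gt0 : 0 < alpha) (alpha_lt1 : alpha < 1).
Variable S : op_graph mu.
Hypothesis S_self : self_adjoint S.
Hypothesis S_dom : Dom S = Halpha df alpha.
Hypothesis S_form : forall f g Sf Sg : L2 mu, S f Sf -> S g Sg ->
  Ealpha df alpha f g = L2dot Sf Sg.
Variables (lam : nat -> R) (psi : nat -> L2 mu).
Hypothesis lam_homo : {homo lam : m n / (m <= n)%N >-> m <= n}.
Hypothesis lam_enum : eigen_enum (@L2dot _ _ R mu) S lam psi.

Let S_adj f h : S f h <-> (forall u v, S u v -> L2dot v f = L2dot u h).
Proof. by case: S_self => _ _; exact. Qed.

Let dotP := L2dot_psd mu.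

Let df_gt0 : 0 < df. Proof. exact: ahl_df ahl. Qed.

Let p := 2 * alpha / df.

Let p_gt0 : 0 < p. Proof. by rewrite divr_gt0// mulr_gt0. Qed.

Lemma graph_energy_fin f g : S f g -> (energy mu s f < +oo)%E.
Proof.
by move=> Sfg; rewrite -HalphaE -S_dom; exists g.
Qed.

Lemma graph_energy f g : S f g -> L2dot g g = 2^-1 * fine (energy mu s f).
Proof. by move=> Sfg; rewrite -(S_form Sfg Sfg) EalphaE. Qed.

Lemma weyl_lower_bound : exists2 c1, 0 < c1 &
  forall n, (0 < n)%N -> c1 * n%:R `^ p <= lam n.
Proof.
have [A1 A10 hA1] := poincare_net ahl alpha_gt0.
exists (A1^-1 * A1 `^ (- p)); first by rewrite mulr_gt0 ?invr_gt0 ?powR_gt0.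
move=> n n0; have nR0 : 0 < n%:R :> R by rewrite ltr0n.
(* Chosen so that [A1 * r ^ (-df) = n]: at most [n] functionals are used, also against the maximum
   with 1 since [0 < n]. *)
pose r := (A1 / n%:R) `^ df^-1.
have An0 : 0 < A1 / n%:R by rewrite divr_gt0.
have r0 : 0 < r by rewrite powR_gt0.
have [k [w [kn hw]]] := hA1 r r0.
have rE : A1 * r `^ (- df) = n%:R.
  rewrite /r -powRrM mulrN mulVf ?gt_eqF// powR_inv1 ?ltW// invf_div mulrCA.
  by rewrite mulfV ?mulr1// gt_eqF.
have {}kn : (k <= n)%N.
  by rewrite -(ler_nat R) (le_trans kn)// rE ge_max lexx ler1n n0.
have e0 : 0 < A1 * r `^ (2 * alpha) by rewrite mulr_gt0// powR_gt0.
have := eigenvalue_lower_bound dotP S_adj lam_enum lam_homo kn e0 (w := w) _.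
move=> h; have {}h := h _; have : 1 <= A1 * r `^ (2 * alpha) * lam n.
  apply: h => f f' Sff'; rewrite (graph_energy Sff'); apply: hw.
  exact: graph_energy_fin Sff'.
rewrite -ler_pdivrMl// mulr1 invfM; apply: le_trans.
rewrite -mulrA ler_pM2l ?invr_gt0// le_eqVlt; apply/orP; left; apply/eqP.
rewrite -powRN /r -powRrM powRM ?invr_ge0 ?(ltW A10) ?(ltW nR0)//.
rewrite -[n%:R^-1]powR_inv1 ?ltW// -powRrM.
by congr (_ `^ _ * _ `^ _); rewrite /p; field; rewrite gt_eqF.
Qed.

Lemma laplacian_compact_embedding : compact_embedding (@L2dot _ _ R mu) S.
Proof.
move=> e e0; have [A1 A10 hA1] := poincare_net ahl alpha_gt0.
pose r := (e / A1) `^ (2 * alpha)^-1.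
have eA0 : 0 < e / A1 by rewrite divr_gt0.
have r0 : 0 < r by rewrite powR_gt0.
have [k [w [_ hw]]] := hA1 r r0.
exists [seq w i | i <- index_enum 'I_k] => f f' Sff'.
rewrite big_map (graph_energy Sff').
have -> : e = A1 * r `^ (2 * alpha).
  rewrite /r -powRrM mulVf ?powRr1 ?ltW//; last by rewrite gt_eqF// mulr_gt0.
  by rewrite mulrCA mulfV ?mulr1// gt_eqF.
by apply: hw; exact: graph_energy_fin Sff'.
Qed.

Lemma weyl_upper_bound : exists2 C1, 0 < C1 &
  forall n, (0 < n)%N -> lam n <= C1 * n%:R `^ p.
Proof.
have [b [B [b0 B0 hB]]] := trial_space ahl alpha_gt0 alpha_lt1.
have D0 := ahl_D ahl.
(* The second term keeps [r <= D / 4] for every [n], hence [2 * r < D]. *)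
pose b' := Num.min b ((D / 4) `^ df).
have b'0 : 0 < b' by rewrite lt_min b0 ?powR_gt0 ?divr_gt0.
exists (B * (2 / b') `^ p); first by rewrite mulr_gt0 ?powR_gt0 ?divr_gt0.
move=> n n0.
have nR0 : 0 < n.+1%:R :> R by rewrite ltr0n.
(* With this scale there are at least [n + 1] tents. *)
pose r := (b' / n.+1%:R) `^ df^-1.
have bn0 : 0 < b' / n.+1%:R by rewrite divr_gt0.
have r0 : 0 < r by rewrite powR_gt0.
have rdf : r `^ df = b' / n.+1%:R.
  by rewrite /r -powRrM mulVf ?powRr1 ?ltW// gt_eqF.
have rD : 2 * r < D.
  suff : r <= D / 4 by lra.
  have -> : D / 4 = ((D / 4) `^ df) `^ df^-1.
    by rewrite -powRrM mulfV ?gt_eqF// powRr1// divr_ge0// ltW.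
  rewrite ge0_ler_powR ?invr_ge0 ?(ltW df_gt0) ?nnegrE ?powR_ge0 ?(ltW bn0)//.
  rewrite ler_pdivrMr// (@le_trans _ _ ((D / 4) `^ df))//.
    by rewrite ge_min lexx orbT.
  by rewrite ler_peMr ?powR_ge0// ler1n.
have [N [u [bN uE hu]]] := hB r r0 rD.
have nN : (n < N)%N.
  rewrite -(ler_nat R) (le_trans _ bN)// powRN rdf invf_div mulrA.
  rewrite ler_pdivlMr// [leRHS]mulrC ler_wpM2l ?ler0n//.
  by rewrite ge_min lexx.
case: N u bN uE hu nN => [//|N] u bN uE hu nN.
have /choice[u' hu'] : forall i, exists g, S (u i) g.
  by move=> i; have : Dom S (u i) by rewrite S_dom HalphaE; exact: uE.
(* All the tents are used: the bound is proved for a possibly later eigenvalue and passed down to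
   [lam n] by monotonicity. *)
rewrite ltnS in nN; have lamN := lam_homo nN; apply: (le_trans lamN).
apply: (@le_trans _ _ (B * r `^ (- (2 * alpha)))); last first.
  rewrite -mulrA ler_pM2l//.
  have -> : r `^ (- (2 * alpha)) = (n.+1%:R / b') `^ p.
    have -> : n.+1%:R / b' = (b' / n.+1%:R)^-1 by rewrite invf_div.
    rewrite -(powR_inv1 (ltW bn0)) /r -!powRrM; congr (_ `^ _).
    by rewrite /p; field; rewrite gt_eqF.
  rewrite -powRM ?divr_ge0 ?(ltW b'0)// ge0_ler_powR ?nnegrE ?(ltW p_gt0)//.
  - by rewrite divr_ge0// ltW.
  - by rewrite mulr_ge0// divr_ge0// ltW.
  (* [n + 1 <= 2 * n] for positive [n]; this is the 2 in the constant. *)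
  - rewrite mulrAC ler_pM2r ?invr_gt0// -natrM ler_nat mul2n -addnn -addn1.
    by rewrite leq_add2l.
apply: (eigenvalue_upper_bound dotP (@L2dot_complete _ _ _ mu) S_adj lam_enum
  lam_homo laplacian_compact_embedding hu') => e e_neq0.
have [h1 h2] := hu e; split; first exact: h1.
have Sf := graph_sum dotP S_adj (index_enum _) predT e hu'.
by rewrite (graph_energy Sf).
Qed.

(** If [lam 0] were nonzero, no index would carry the eigenvalue 0, and [enum_span] would make the
    constant function null although the total mass is positive. *)
Lemma eigenvalue0 : [/\ lam 0%N = 0 & [set n | lam n = 0] = [set 0%N]].
Proof.
have [c1 c10 hc1] := weyl_lower_bound.
have lam_gt0 n : (0 < n)%N -> 0 < lam n.
  move=> n0; apply: lt_le_trans (hc1 n n0).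
  by rewrite mulr_gt0// powR_gt0// ltr0n.
have mass0 := total_mass_gt0 ahl.
pose one : L2 mu := Lfun_Sub (lee1n 2) (Lfun_cst mu 1 2).
have one_dot : L2dot one one = fine (mu setT).
  rewrite (_ : L2dot one one = \int[mu]_(x in setT) (cst 1 x)); last first.
    by apply: eq_Rintegral => x _; rewrite /= mulr1.
  by rewrite Rintegral_cst// mul1r.
have one_energy : energy mu s one = 0%E.
  apply: integral0_eq => x _; apply: integral0_eq => y _.
  by rewrite /gagliardo /one /= subrr expr0n mul0r.
have eig1 : eigvec S 0 one.
  have [g Sg] : Dom S one by rewrite S_dom HalphaE one_energy.
  have g0 : L2dot g g = 0 by rewrite (graph_energy Sg) one_energy mulr0.
  (* The image [g] is null but perhaps not the zero function; the adjoint relation allows [0] in its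
     place. *)
  exists 0; last by rewrite scale0r; exact: (graph0 dotP S_adj).
  apply/S_adj => u v uv; rewrite (graph_sym S_adj Sg uv).
  by rewrite (psd_sym dotP) (dot_null dotP)// (psd_sym dotP) (dot0l dotP).
have lam00 : lam 0%N = 0.
  apply: contrapT => l0.
  have : L2dot one one = 0.
    apply: (enum_span lam_enum eig1) => n ln.
    case: n ln => [//|n] ln; have := lam_gt0 n.+1 isT.
    by rewrite ln ltxx.
  by rewrite one_dot => h; move: mass0; rewrite h ltxx.
split => //; apply/seteqP; split => [n /= ln|n /= -> //].
case: n ln => [//|n] ln; have := lam_gt0 n.+1 isT.
by rewrite ln ltxx.
Qed.

End Bounds.

End Laplacian.

Theorem corollary2p9 (R : realType) (X : pmetricType R)
    (mu : {finite_measure set (borel X) -> \bar R}) (df alpha : R)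
    (cptX : compact [set: X]) (df_gt0 : 0 < df)
    (mu_reg : ahlfors_regular mu df)
    (alpha_gt0 : 0 < alpha) (alpha_lt1 : alpha < 1)
    (Delta : op_graph mu) (Delta_lap : is_dirichlet_laplacian df alpha Delta)
    (lam : nat -> R) (lam_eig : eigenvalue_sequence Delta lam) :
  (exists c C : R, [/\ 0 < c, c <= C &
     forall n : nat, c * n%:R `^ (2 * alpha / df) <= lam n
                     /\ lam n <= C * n%:R `^ (2 * alpha / df)]) /\
  (lam 0%N = 0 /\ has_dim (op_eigenspace Delta 0) 1).
Proof.
have [_ [S [sqrtS domS formS]]] := Delta_lap.
have [psi enum_psi] := eigenvalue_sequence_enum sqrtS lam_eig.
have D0 := diam_gt0_of_free cptX enum_psi.
have [c [C ahl]] := regular_ahlfors cptX df_gt0 mu_reg D0.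
have [[S_self _] _] := sqrtS; have [lam_homo lam_dim] := lam_eig.
have [c1 c10 low] := weyl_lower_bound ahl alpha_gt0 S_self domS formS lam_homo enum_psi.
have [C1 C10 up] := weyl_upper_bound ahl alpha_gt0 alpha_lt1 S_self domS formS lam_homo enum_psi.
have [lam0 set0E] := eigenvalue0 ahl alpha_gt0 S_self domS formS lam_homo enum_psi.
split; last first.
  (* The dimension is the number of indices [n] with [lam n = 0], that is 1. *)
  split => //; have [k dimk] := lam_dim 0; rewrite set0E -II1 => /card_eq_II k1.
  by rewrite -k1 in dimk.
exists c1, (Num.max c1 C1); split => //; first by rewrite le_max lexx.
have p_neq0 : 2 * alpha / df != 0 by rewrite gt_eqF// divr_gt0// mulr_gt0.
(* At [n = 0] all three terms are 0, since [0] to a nonzero power is 0. *)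
case=> [|n]; first by rewrite lam0 powR0// !mulr0.
split; first exact: low.
by rewrite (le_trans (up _ _))// ler_wpM2r ?powR_ge0// le_max lexx orbT.
Qed.
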